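(* Let $X,Y$ be self-adjoint random variables of a non-commutative probability space $(\mathcal{M},\tau)$ with symmetric laws, and assume that $X,Y$ are Boolean independent. Then $$\frac{1}{\Psi(X+Y)}\ge\frac{1}{\Psi(X)}+\frac{1}{\Psi(Y)}.$$ In particular, if $\Psi(X+Y)=+\infty$, then $\Psi(X)=\Psi(Y)=+\infty$.
   Context: A non-commutative probability space $(\mathcal{M},\tau)$ is a von Neumann algebra $\mathcal{M}$ with a nondegenerate normal state $\tau$, not necessarily faithful. For self-adjoint $A\in\mathcal{M}$, the law of $A$ is the unique probability measure $\mu$ on $\mathbb{R}$ with $\tau(A^k)=\int x^k\,d\mu(x)$ for all $k\in\mathbb{N}$. Two self-adjoint $X,Y\in\mathcal{M}$ are Boolean independent if for all finite sequences of integers $k_1,k_2,\ldots\ge 1$, $\tau(X^{k_1}Y^{k_2}X^{k_3}\cdots)=\tau(X^{k_1})\tau(Y^{k_2})\tau(X^{k_3})\cdots$ and $\tau(Y^{k_1}X^{k_2}Y^{k_3}\cdots)=\tau(Y^{k_1})\tau(X^{k_2})\tau(Y^{k_3})\cdots$. If $X,Y$ have symmetric laws, so does $X+Y$. For $X$ with symmetric law $\mu$, the Boolean Fisher information is $\Psi(X)=\iint\frac{\log x^2-\log y^2}{x^2-y^2}\,d\mu(x)\,d\mu(y)\in(0,+\infty]$, the integrand being understood with its continuous extension on the diagonal $x^2=y^2$ (value $1/x^2$, and $+\infty$ if $x=0$ or $y=0$). Convention: $1/(+\infty)=0$. *)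

(* Defs.v *)
From HB Require Import structures.
From mathcomp Require Import all_boot all_order all_algebra.
From mathcomp Require Import complex sesquilinear.
From mathcomp Require Import all_classical all_reals all_analysis.

Set Implicit Arguments.
Unset Strict Implicit.
Unset Printing Implicit Defensive.

Import Order.TTheory GRing.Theory Num.Theory.
Import numFieldNormedType.Exports.

Local Open Scope classical_set_scope.
Local Open Scope complex_scope.
Local Open Scope ring_scope.

(* The inner product is linear in its first argument and conjugate-linear in
   the second one; completeness is that of [completeNormedModType]. *)
Record hilbertSpace (R : realType) := HilbertSpace {
  hspace :> completeNormedModType R[i];
  hdot : {dot hspace for (@Num.conj R[i])};
  hdot_norm : forall x : hspace, `|x| ^+ 2 = hdot x x
}.

Notation "'[| x , y |]" := (hdot _ x y)
  (at level 0, x, y at level 99, format "''[|' x ,  y '|]'") : ring_scope.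

Section Operators.
Context {R : realType} {H : hilbertSpace R}.
Implicit Types (A B S T : H -> H) (M D : set (H -> H)).

Definition bounded_operator : set (H -> H) :=
  [set A | linear A /\ continuous A].

Definition adjoint A B := forall x y : H, '[| A x, y |] = '[| x, B y |].

Definition self_adjoint A := adjoint A A.

(* On R[i], [0 <= z] means that z is real and nonnegative. *)
Definition op_le A B := forall x : H, 0 <= '[| B x - A x, x |].

Definition commutant M : set (H -> H) :=
  [set T | bounded_operator T /\ forall A, M A -> T \o A = A \o T].

Record von_neumann_algebra M : Prop := VonNeumannAlgebra {
  vna_bounded : M `<=` bounded_operator;
  vna_id : M idfun;
  vna_linear : forall (a : R[i]) A B, M A -> M B -> M (a \*: A \+ B);
  vna_comp : forall A B, M A -> M B -> M (A \o B);
  vna_adjoint : forall A, M A -> exists2 B, M B & adjoint A B;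
  vna_bicommutant : commutant (commutant M) = M
}.

Definition op_supremum M D S :=
  [/\ M S /\ self_adjoint S,
      forall A, D A -> op_le A S
    & forall T, M T -> self_adjoint T -> (forall A, D A -> op_le A T) ->
        op_le S T].

(* Functionals on M are represented by functions on all of H -> H, whose values
   outside M are irrelevant. *)
Record state M (tau : (H -> H) -> R[i]) : Prop := State {
  state_linear : forall (a : R[i]) A B, M A -> M B ->
    tau (a \*: A \+ B) = a * tau A + tau B;
  state_ge0 : forall A B, M A -> M B -> adjoint A B -> 0 <= tau (B \o A);
  state_id : tau idfun = 1
}.

(* Preservation of suprema of bounded increasing nets of self-adjoint
   elements. *)
Definition normal M (tau : (H -> H) -> R[i]) :=
  forall D S, D !=set0 -> (forall A, D A -> M A /\ self_adjoint A) ->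
    (forall A B, D A -> D B -> exists C, [/\ D C, op_le A C & op_le B C]) ->
    op_supremum M D S ->
    supremums [set tau A | A in D] (tau S).

(* The GNS representation of tau is faithful; this is strictly weaker than
   faithfulness of tau. *)
Definition nondegenerate M (tau : (H -> H) -> R[i]) :=
  forall A, M A -> (forall B C, M B -> M C -> tau (B \o A \o C) = 0) ->
    forall x : H, A x = 0.

End Operators.

Record ncProbSpace (R : realType) := NCProbSpace {
  nc_hilbert : hilbertSpace R;
  nc_alg : set (nc_hilbert -> nc_hilbert);
  nc_state : (nc_hilbert -> nc_hilbert) -> R[i];
  nc_algP : von_neumann_algebra nc_alg;
  nc_stateP : state nc_alg nc_state;
  nc_normal : normal nc_alg nc_state;
  nc_nondegenerate : nondegenerate nc_alg nc_state
}.

Notation "'op( W )" := (nc_hilbert W -> nc_hilbert W)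
  (at level 0, W at level 99, format "''op(' W )") : type_scope.

Section RandomVariables.
Context {R : realType} (W : ncProbSpace R).

Definition selfadjoint_element (X : 'op(W)) := nc_alg X /\ self_adjoint X.

Definition op_pow (X : 'op(W)) (k : nat) : 'op(W) := iter k X.

(* At most one mu qualifies, because the moments of a bounded operator grow at
   most geometrically. Each moment is required to be integrable, since the
   integral of a non-integrable function takes a default value. *)
Definition is_law (X : 'op(W)) (mu : probability (measurableTypeR R) R) :=
  forall k : nat,
    mu.-integrable setT (fun x : R => (x ^+ k)%:E) /\
    nc_state (op_pow X k) = (\int[mu]_(x in setT) (x ^+ k))%R%:C.

Fixpoint alternating_word (X Y : 'op(W)) (ks : seq nat) : 'op(W) :=
  if ks is k :: ks' then op_pow X k \o alternating_word Y X ks' else idfun.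

Fixpoint alternating_moments (X Y : 'op(W)) (ks : seq nat) : R[i] :=
  if ks is k :: ks'
  then nc_state (op_pow X k) * alternating_moments Y X ks' else 1.

Definition boolean_independent (X Y : 'op(W)) :=
  forall ks : seq nat, all (leq 1) ks ->
    nc_state (alternating_word X Y ks) = alternating_moments X Y ks /\
    nc_state (alternating_word Y X ks) = alternating_moments Y X ks.

End RandomVariables.

Section FisherInformation.
Context {R : realType}.

Definition symmetric_measure (mu : probability (measurableTypeR R) R) :=
  forall B : set (measurableTypeR R), measurable B ->
    mu (-%R @^-1` B) = mu B.

(* The axes must be tested first, because [ln 0] and [0^-1] are default
   values. *)
Definition fisher_kernel (x y : R) : \bar R :=
  if (x == 0) || (y == 0) then +oo%E
  else if x ^+ 2 == y ^+ 2 then ((x ^+ 2)^-1)%:E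
  else ((ln (x ^+ 2) - ln (y ^+ 2)) / (x ^+ 2 - y ^+ 2))%:E.

Definition boolean_fisher_information
    (mu : probability (measurableTypeR R) R) : \bar R :=
  (\int[mu]_x \int[mu]_y fisher_kernel x y)%E.

End FisherInformation.

(* Main.v *)
Require Import Defs.
From HB Require Import structures.
From mathcomp Require Import all_boot all_order all_algebra.
From mathcomp Require Import complex sesquilinear.
From mathcomp Require Import all_classical all_reals all_analysis.
From mathcomp Require Import measurable_realfun ring lra.

Set Implicit Arguments.
Unset Strict Implicit.
Unset Printing Implicit Defensive.

Import Order.TTheory GRing.Theory Num.Theory.
Import numFieldNormedType.Exports.

Local Open Scope classical_set_scope.
Local Open Scope complex_scope.
Local Open Scope ring_scope.

(* Write [g t] for the integral of [1 / (x ^+ 2 + t)] against a law. As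
   [(ln a - ln b) / (a - b)] is the integral over [t > 0] of
   [1 / ((a + t) (b + t))], the information is the integral of [g t ^+ 2]
   (Tonelli). Boolean independence gives, for symmetric laws,
   [1 / gXY t = 1 / gX t + 1 / gY t - t] at every [t > 0]. Moreover
   [1 / g t - t] is nonnegative and nondecreasing (Chebyshev's association
   inequality), so that for [l + m = 1], with [p = 1 / gX (l t)] and
   [q = 1 / gY (m t)], one has [1 / gXY t >= p + q], hence by convexity
   [gXY t ^+ 2 <= l ^+ 3 / p ^+ 2 + m ^+ 3 / q ^+ 2]. Integrating and rescaling
   [t] yields [PsiXY <= l ^+ 2 PsiX + m ^+ 2 PsiY]; take [l] proportional to
   [PsiY].
   The formula for [gXY] comes from the resolvents at [z = i * sqrt t]: by
   Boolean independence [Y] kills the centered resolvent of [X] in the GNS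
   space and vice versa, so the resolvent of [X + Y], applied to the cyclic
   vector, is an explicit combination of those of [X] and [Y]. No analytic
   continuation is needed: since the laws have bounded support, resolvents are
   approximated by truncated geometric series, which are polynomials. *)

(** * The algebra as an algebra over the complex numbers *)

Section OperatorAlgebra.
Context (R : realType) (W : ncProbSpace R).

Definition in_nc_alg : pred 'op(W) := fun A => `[< nc_alg A >].

(** As a type of its own, the von Neumann algebra carries an algebra structure with composition as
    product, so that polynomials in an operator are values of [horner_alg]. *)
Definition ncalg : Type := {A : 'op(W) | in_nc_alg A}.

HB.instance Definition _ := SubType.on ncalg.
HB.instance Definition _ := [Choice of ncalg by <:].

Lemma in_nc_algP (A : 'op(W)) : reflect (nc_alg A) (in_nc_alg A).
Proof. exact: asboolP. Qed.

Lemma ncalgP (a : ncalg) : nc_alg (val a).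
Proof. exact/in_nc_algP/valP. Qed.

Lemma nc_alg0 : nc_alg (0 : 'op(W)).
Proof.
have P := nc_algP W.
have := vna_linear P (-1) (vna_id P) (vna_id P).
congr nc_alg; apply/funext => x /=.
by rewrite /GRing.add_fun /GRing.scale_fun /= scaleN1r addNr.
Qed.

Lemma in_nc_alg_submod : subsemimod_closed in_nc_alg.
Proof.
have P := nc_algP W.
have Z (c : R[i]) (A : 'op(W)) : nc_alg A -> nc_alg (c *: A).
  move=> MA; have := vna_linear P c MA nc_alg0.
  by congr nc_alg; apply/funext => x /=; rewrite addr0.
split.
  split; first exact/in_nc_algP/nc_alg0.
  move=> A B /in_nc_algP MA /in_nc_algP MB; apply/in_nc_algP.
  have := vna_linear P 1 MA MB.
  by congr nc_alg; apply/funext => x /=; rewrite /GRing.scale_fun scale1r.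
by move=> c A /in_nc_algP MA; exact/in_nc_algP/Z.
Qed.

HB.instance Definition _ :=
  GRing.SubChoice_isSubLmodule.Build R[i] 'op(W) in_nc_alg ncalg in_nc_alg_submod.

Lemma nc_op_linear (a : ncalg) : linear (val a).
Proof. exact: (vna_bounded (nc_algP W) (ncalgP a)).1. Qed.

Lemma nc_opD (a : ncalg) x y : val a (x + y) = val a x + val a y.
Proof. by have := nc_op_linear a 1 x y; rewrite !scale1r. Qed.

Lemma nc_op0 (a : ncalg) : val a 0 = 0.
Proof. by apply: (addIr (val a 0)); rewrite -nc_opD !add0r. Qed.

Lemma nc_opZ (a : ncalg) c x : val a (c *: x) = c *: val a x.
Proof. by have := nc_op_linear a c x 0; rewrite nc_op0 !addr0. Qed.

Definition ncone : ncalg :=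
  exist _ idfun (introT (in_nc_algP _) (vna_id (nc_algP W))).

Definition ncmul (a b : ncalg) : ncalg :=
  exist _ (val a \o val b)
    (introT (in_nc_algP _) (vna_comp (nc_algP W) (ncalgP a) (ncalgP b))).

Fact ncmulA : associative ncmul. Proof. by move=> a b c; exact: val_inj. Qed.
Fact ncmul1 : left_id ncone ncmul. Proof. by move=> a; exact: val_inj. Qed.
Fact nc1mul : right_id ncone ncmul. Proof. by move=> a; exact: val_inj. Qed.
Fact ncmulDl : left_distributive ncmul +%R.
Proof. by move=> a b c; apply: val_inj. Qed.
Fact ncmulDr : right_distributive ncmul +%R.
Proof. by move=> a b c; apply: val_inj; apply/funext => x; exact: nc_opD. Qed.

HB.instance Definition _ := GRing.Zmodule_isPzRing.Build ncalg
  ncmulA ncmul1 nc1mul ncmulDl ncmulDr.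

Definition nctau (a : ncalg) : R[i]^o := nc_state (val a).

Fact nctau_linear : linear nctau.
Proof.
by move=> c a b; exact: (state_linear (nc_stateP W) c (ncalgP a) (ncalgP b)).
Qed.
HB.instance Definition _ :=
  GRing.isLinear.Build R[i] ncalg R[i]^o *:%R nctau nctau_linear.

Lemma nctau1 : nctau 1 = 1. Proof. exact: (state_id (nc_stateP W)). Qed.

Fact ncalg_nontrivial : (1 : ncalg) != 0.
Proof.
apply/eqP => e; have := nctau1; rewrite e linear0 => /esym/eqP.
by rewrite oner_eq0.
Qed.
HB.instance Definition _ := GRing.PzSemiRing_isNonZero.Build ncalg ncalg_nontrivial.

Fact ncscaleAl (c : R[i]) (a b : ncalg) : c *: (a * b) = (c *: a) * b.
Proof. exact: val_inj. Qed.
HB.instance Definition _ := GRing.Lmodule_isLalgebra.Build R[i] ncalg ncscaleAl.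

Fact ncscaleAr (c : R[i]) (a b : ncalg) : c *: (a * b) = a * (c *: b).
Proof. by apply: val_inj; apply/funext => x /=; rewrite nc_opZ. Qed.
HB.instance Definition _ := GRing.Lalgebra_isAlgebra.Build R[i] ncalg ncscaleAr.

End OperatorAlgebra.

(** * Positive functionals and Boolean independence *)

Section LinearFunctional.
Context (C : fieldType) (A : algType C) (tau : {linear A -> C^o}).
Implicit Types a b : A.

Lemma horner_algE a (p : {poly C}) :
  horner_alg a p = \sum_(i < size p) p`_i *: a ^+ i.
Proof.
rewrite /horner_alg /horner_morph (@horner_coef_wide _ (size p)) ?size_map_poly //.
by apply: eq_bigr => i _; rewrite coef_map /= mulr_algl.
Qed.

(** Both sides are linear in [p] and in [q], so monomials suffice. *)
Lemma sandwich_polynomial a b :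
  (forall i j, tau (a ^+ i * b * a ^+ j) = tau (a ^+ i) * tau b * tau (a ^+ j)) ->
  forall p q : {poly C}, tau (horner_alg a p * b * horner_alg a q) =
    tau (horner_alg a p) * tau b * tau (horner_alg a q).
Proof.
move=> H p q; rewrite !horner_algE !linear_sum /= !mulr_suml linear_sum /=.
refine (eq_bigr _ _) => i _; rewrite !mulr_sumr linear_sum /=.
refine (eq_bigr _ _) => j _.
rewrite -!scalerAl -!scalerAr !linearZ /= H /GRing.scale /=; ring.
Qed.

(* For exact resolvents ([e = e' = e'' = 0]) the right-hand side vanishes and this
   is the additivity of [z - 1 / tau ((z - _)^-1)] under Boolean convolution. *)
Lemma boolean_resolvent_identity (x y u v g e e' e'' : A) (z : C) :
  tau 1 = 1 ->
  (z%:A - x) * u = 1 - e -> (z%:A - y) * v = 1 - e' ->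
  g * (z%:A - (x + y)) = 1 - e'' ->
  tau (g * (y * (u - (tau u)%:A))) = 0 -> tau (g * (x * (v - (tau v)%:A))) = 0 ->
  tau u * tau v - (tau u + tau v - z * tau u * tau v) * tau g =
  tau v * tau (e'' * u) + tau u * tau (e'' * v) - tau u * tau v * tau e''
  - tau v * tau (g * e) - tau u * tau (g * e').
Proof.
move=> tau1 hu hv hg; set al := tau u; set be := tau v => hyu hxv.
(* This is [hg] multiplied by [w] on the right; it serves for [w = 1], [u] and [v]. *)
have hmul w : tau (e'' * w) =
    tau w - (z * tau (g * w) - tau (g * (x * w)) - tau (g * (y * w))).
  have -> : e'' = 1 - g * (z%:A - (x + y)) by rewrite hg subKr.
  rewrite mulrBl mul1r linearB; congr (_ - _).
  rewrite -mulrA !(mulrBl, mulrDl) !(mulrBr, mulrDr) -!scalerAl mul1r -scalerAr.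
  by rewrite linearB linearD linearZ opprD addrA.
have hge w w' d : (z%:A - w) * w' = 1 - d ->
    tau (g * d) = tau g - (z * tau (g * w') - tau (g * (w * w'))).
  move=> hd; have -> : d = 1 - (z%:A - w) * w' by rewrite hd subKr.
  rewrite mulrBr mulr1 linearB; congr (_ - _).
  by rewrite mulrBl mulrBr -scalerAl mul1r -scalerAr linearB linearZ.
(* By centering, after multiplication by [g] on the left, [tau] does not distinguish [y * u] from
   [tau u] times [y], nor [x * v] from [tau v] times [x]. The remaining unknowns then cancel. *)
have hc w w' (k : C) : tau (g * (w * (w' - k%:A))) = 0 ->
    tau (g * (w * w')) = k * tau (g * w).
  rewrite !mulrBr -!scalerAr mulr1 linearB linearZ => /eqP.
  by rewrite subr_eq0 => /eqP.
have := hmul 1; rewrite !mulr1 tau1 => ->.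
rewrite !hmul (hge _ _ _ hu) (hge _ _ _ hv) (hc _ _ _ hyu) (hc _ _ _ hxv) -/al -/be.
ring.
Qed.

End LinearFunctional.

(** Nothing relates [c] and [d] beforehand: since a nonnegative complex number is real, positivity
    forces [P] and [Q] to be real and [d = c^*]. Hermitian symmetry thus comes out of positivity. *)
Lemma complex_discriminant (R : realType) (P Q c d : R[i]) :
  (forall s : R[i], 0 <= P + s^* * c + s * d + s * s^* * Q) ->
  `|c| ^+ 2 <= P * Q.
Proof.
case: P Q c d => [p p'] [q q'] [a b] [e f] H.
have {}H u v : (p' + (u * b - v * a) + (u * f + v * e) +
   ((u * u + v * v) * q') = 0) /\ 0 <= p + (u * a + v * b) + (u * e - v * f) +
   (u * u + v * v) * q.
  have := H (u +i* v); rewrite lecE /= => /andP[/eqP h1 h2]; split.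
    by rewrite -[RHS]h1; ring.
  by lra.
(* The values 0, 1, -1, i and -i of [s] settle all imaginary parts. *)
have [h00 p0] := H 0 0; have [h10 _] := H 1 0; have [h20 _] := H (-1) 0.
have [h01 _] := H 0 1; have [h02 _] := H 0 (-1).
have p'0 : p' = 0 by lra.
have q'0 : q' = 0 by lra.
have ae : e = a by lra.
have bf : f = - b by lra.
subst p' q' e f.
have pg0 : 0 <= p by lra.
set k := a ^+ 2 + b ^+ 2.
have k0 : 0 <= k by rewrite addr_ge0 ?sqr_ge0.
(* This is the choice [s = - r * c], aligned with the linear term. *)
have Hr r : 0 <= p - r * k *+ 2 + r ^+ 2 * k * q.
  have [_ h] := H (- r * a) (- r * b).
  by rewrite /k; lra.
have q0 : 0 <= q.
  rewrite leNgt; apply/negP => q_lt0; set m := (p + 1) / - q.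
  have mq : m * q = - (p + 1) by rewrite /m; field; rewrite lt_eqF.
  have m0 : 0 <= m by rewrite divr_ge0 ?oppr_ge0 ?ltW //; lra.
  (* Averaging over two opposite values removes the linear term, and [m] is large enough for the
     negative quadratic term to outweigh [p]. *)
  have [_ h1] := H (1 + m) 0; have [_ h2] := H (- (1 + m)) 0.
  have : 0 <= p + (1 + m) ^+ 2 * q by lra.
  have -> : p + (1 + m) ^+ 2 * q = p + q + m * q *+ 2 + m * (m * q) by ring.
  by rewrite mq; nra.
have kpq : k <= p * q.
  (* If [q > 0], the minimum over [r] is at [q^-1]; if [q = 0], the bound is affine in [r] and
     excludes [k > 0]. *)
  have [q_gt0|q_le0] := ltP 0 q.
    have := Hr q^-1; have -> : p - q^-1 * k *+ 2 + q^-1 ^+ 2 * k * q = p - k / q.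
      by field; rewrite gt_eqF.
    by rewrite subr_ge0 ler_pdivrMr.
  have -> : q = 0 by apply/le_anti; rewrite q_le0 q0.
  rewrite mulr0 leNgt; apply/negP => k_gt0.
  have := Hr ((p + 1) / k).
  have -> : (p + 1) / k * k = p + 1 by rewrite divfK ?gt_eqF.
  have -> : q = 0 by apply/le_anti; rewrite q_le0 q0.
  lra.
rewrite -add_Re2_Im2 /= lecE /= -/k; apply/andP; split; first by apply/eqP; ring.
by rewrite !mulr0 subr0.
Qed.

Section PositiveFunctional.
Context (R : realType) (W : ncProbSpace R).
Implicit Types a b c : ncalg W.

(** A relation and not a map: adjoints in the algebra are given by mere existence, so the lemmas
    carry both members of each pair. *)
Definition adj a b := adjoint (val a) (val b).

Lemma hdotC (H : hilbertSpace R) (x y : H) : '[| x, y |] = '[| y, x |]^*.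
Proof. by rewrite (hermC (hdot H) x y) expr0 mul1r. Qed.

Lemma adj_sym a b : adj a b -> adj b a.
Proof. by move=> h x y; rewrite hdotC -h -hdotC. Qed.

Lemma adj1 : adj 1 1. Proof. by []. Qed.

Lemma adjD a a' b b' : adj a a' -> adj b b' -> adj (a + b) (a' + b').
Proof.
move=> ha hb x y.
have -> : val (a + b) x = val a x + val b x by [].
have -> : val (a' + b') y = val a' y + val b' y by [].
by rewrite linearDl linearDr /= ha hb.
Qed.

Lemma adjZ (k : R[i]) a a' : adj a a' -> adj (k *: a) (k^* *: a').
Proof.
move=> ha x y.
have -> : val (k *: a) x = k *: val a x by [].
have -> : val (k^* *: a') y = k^* *: val a' y by [].
by rewrite linearZl linearZr /= ha conjCK.
Qed.

Lemma adjM a a' b b' : adj a a' -> adj b b' -> adj (a * b) (b' * a').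
Proof.
move=> ha hb x y.
have -> : val (a * b) x = val a (val b x) by [].
by rewrite ha hb.
Qed.

Lemma nctau_ge0 a a' : adj a a' -> 0 <= nctau (a' * a).
Proof. exact: (state_ge0 (nc_stateP W) (ncalgP a) (ncalgP a')). Qed.

(** Positivity of the state at [a + s *: b], for every complex [s], is the quadratic inequality of
    [complex_discriminant]. *)
Lemma nctau_cauchy_schwarz a a' b b' : adj a a' -> adj b b' ->
  `|nctau (b' * a)| ^+ 2 <= nctau (a' * a) * nctau (b' * b).
Proof.
move=> ha hb.
apply: (@complex_discriminant _ _ _ _ (nctau (a' * b))) => s.
have := nctau_ge0 (adjD ha (adjZ s hb)).
rewrite mulrDr !mulrDl -!scalerAl -!scalerAr !linearD !linearZ /=.
by rewrite !addrA.
Qed.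

Lemma nctau_norm_le a a' b b' (p q : R) : adj a a' -> adj b b' ->
  0 <= p -> 0 <= q ->
  nctau (a' * a) <= (p ^+ 2)%:C -> nctau (b' * b) <= (q ^+ 2)%:C ->
  `|nctau (b' * a)| <= (p * q)%:C.
Proof.
move=> ha hb p0 q0 hp hq; rewrite -(@ler_pXn2r _ 2) // ?nnegrE ?ler0c ?mulr_ge0 //.
apply: le_trans (nctau_cauchy_schwarz ha hb) _.
by rewrite -rmorphXn exprMn rmorphM ler_pM ?nctau_ge0.
Qed.

Lemma adj_horner_alg a (p : {poly R[i]}) : adj a a ->
  adj (horner_alg a p) (horner_alg a (map_poly (@Num.conj R[i]) p)).
Proof.
move=> ha; elim/poly_ind: p => [|p c IH].
  rewrite rmorph0 !linear0 => x y.
  by rewrite (_ : val 0 x = 0) // (_ : val 0 y = 0) // linear0l linear0.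
rewrite !rmorphD !rmorphM /= map_polyX map_polyC /= !horner_algC horner_algX.
apply: adjD; last exact/adjZ/adj1.
rewrite -{2}[a]horner_algX -rmorphM mulrC rmorphM /= horner_algX.
exact: adjM.
Qed.

Lemma val_ncexp a k : val (a ^+ k) = iter k (val a).
Proof.
elim: k => [|k IH]; first by rewrite expr0.
by rewrite exprS (_ : val (a * a ^+ k) = val a \o val (a ^+ k)) // IH.
Qed.

End PositiveFunctional.

Section BooleanResolvent.
Context (R : realType) (W : ncProbSpace R) (X Y : ncalg W).
Hypothesis indXY : boolean_independent (val X) (val Y).

(** Boolean independence only concerns exponents at least 1, so the cases [i = 0] and [j = 0] go
    through shorter words. *)
Lemma nctau_sandwich_monomial i j :
  nctau (X ^+ i * Y ^+ 2 * X ^+ j) =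
  nctau (X ^+ i) * nctau (Y ^+ 2) * nctau (X ^+ j).
Proof.
have E k (a : ncalg W) : nctau (a ^+ k) = nc_state (op_pow (val a) k).
  by rewrite /nctau val_ncexp.
case: i j => [|i] [|j].
- by rewrite !expr0 mul1r mulr1 nctau1 mul1r mulr1.
- have [_] := indXY (ks := [:: 2%N; j.+1]) isT.
  rewrite /= mulr1 -!E expr0 nctau1 !mul1r => <-.
  by rewrite {1}/nctau (_ : val _ = val (Y ^+ 2) \o val (X ^+ j.+1)) // !val_ncexp.
- have [+ _] := indXY (ks := [:: i.+1; 2%N]) isT.
  rewrite /= mulr1 -!E expr0 nctau1 !mulr1 => <-.
  by rewrite {1}/nctau (_ : val _ = val (X ^+ i.+1) \o val (Y ^+ 2)) // !val_ncexp.
have [+ _] := indXY (ks := [:: i.+1; 2%N; j.+1]) isT.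
rewrite /= mulr1 -!E mulrA => <-; rewrite {1}/nctau.
rewrite (_ : val _ = val (X ^+ i.+1) \o val (Y ^+ 2) \o val (X ^+ j.+1)) //.
by rewrite !val_ncexp.
Qed.

Lemma nctau_sandwich (p q : {poly R[i]}) :
  nctau (horner_alg X p * Y ^+ 2 * horner_alg X q) =
  nctau (horner_alg X p) * nctau (Y ^+ 2) * nctau (horner_alg X q).
Proof. exact: (sandwich_polynomial nctau_sandwich_monomial). Qed.

(* By the sandwich formula [Y * horner_alg X p] has norm 0 in the GNS space. *)
Lemma nctau_mul_centered (b : ncalg W) (p : {poly R[i]}) (b' : ncalg W) :
  adj b b' -> adj X X -> adj Y Y -> nctau (horner_alg X p) = 0 ->
  nctau (b * (Y * horner_alg X p)) = 0.
Proof.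
move=> hb hX hY p0; apply/eqP; rewrite -normr_eq0 -sqrf_eq0; apply/eqP.
have hp := adjM hY (adj_horner_alg p hX).
apply/le_anti/andP; split; last exact: exprn_ge0.
apply: le_trans (nctau_cauchy_schwarz hp (adj_sym hb)) _.
rewrite [X in nctau X * _](_ : _ =
  horner_alg X (map_poly (@Num.conj R[i]) p) * Y ^+ 2 * horner_alg X p).
  by rewrite nctau_sandwich p0 mulr0 mul0r.
by rewrite expr2 !mulrA.
Qed.

End BooleanResolvent.

(** * Approximate resolvents and their error terms *)

Section ResolventEstimate.
Context (R : realType) (W : ncProbSpace R).
Variables (s eps : R) (r e : {poly R}).
Hypotheses (s_gt0 : 0 < s) (eps_ge0 : 0 <= eps).
Hypothesis re : ('X^2 + (s ^+ 2)%:P) * r = 1 - e.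

Local Notation cpx := (map_poly (real_complex R)).
Let z : R[i] := 0 +i* s.

Definition has_moments (a : ncalg W) (L : {poly R} -> R) :=
  forall p : {poly R}, nctau (horner_alg a (cpx p)) = (L p)%:C.

(** As [z ^+ 2 = - s ^+ 2], the inverse of [z - x] is [- (z + x) / (x ^+ 2 + s ^+ 2)]. With [r] in
    place of [1 / (x ^+ 2 + s ^+ 2)], the argument [- z] thus gives the resolvent at [z] up to [e],
    and the argument [z] gives its adjoint. *)
Definition resolvent_poly (w : R[i]) : {poly R[i]} := (w%:P - 'X) * (cpx r).

Let U (a : ncalg W) := horner_alg a (resolvent_poly (- z)).
Let U' (a : ncalg W) := horner_alg a (resolvent_poly z).
Let E (a : ncalg W) := horner_alg a (cpx e).

Let sqr_z : z ^+ 2 = - (s ^+ 2)%:C.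
Proof.
rewrite expr2; apply/eqP; rewrite eq_complex /=.
by apply/andP; split; apply/eqP; ring.
Qed.

Let resolvent_polyE : (z%:P - 'X) * resolvent_poly (- z) = 1 - (cpx e).
Proof.
rewrite /resolvent_poly mulrA -(rmorph1 (map_poly (real_complex R))) -rmorphB /= -re.
rewrite rmorphM /= rmorphD /= map_polyXn map_polyC /=; congr (_ * _).
have -> : (s ^+ 2)%:C = - z ^+ 2 by rewrite sqr_z opprK.
rewrite !rmorphN rmorphXn /=; ring.
Qed.

Let horner_algBX (a : ncalg W) : horner_alg a (z%:P - 'X) = z%:A - a.
Proof. by rewrite rmorphB /= horner_algC horner_algX. Qed.

Let UE a : (z%:A - a) * U a = 1 - E a.
Proof. by rewrite -horner_algBX -rmorphM resolvent_polyE rmorphB rmorph1. Qed.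

Let UEr a : U a * (z%:A - a) = 1 - E a.
Proof. by rewrite -horner_algBX -rmorphM mulrC resolvent_polyE rmorphB rmorph1. Qed.

Let conj_poly (p : {poly R}) : map_poly (@Num.conj R[i]) (cpx p) = (cpx p).
Proof.
apply/polyP => i; rewrite !coef_map /=. exact: (conjc_real p`_i).
Qed.

Let conj_Nz : (- z)^* = z.
Proof. by apply/eqP; rewrite eq_complex /= !oppr0 opprK !eqxx. Qed.

Let conj_resolvent w :
  map_poly (@Num.conj R[i]) (resolvent_poly w) = resolvent_poly w^*.
Proof. by rewrite rmorphM /= conj_poly rmorphB /= map_polyX map_polyC. Qed.

Let adjU a : adj a a -> adj (U a) (U' a).
Proof.
by move=> /(adj_horner_alg (resolvent_poly (- z))); rewrite conj_resolvent conj_Nz.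
Qed.

Let adjE a : adj a a -> adj (E a) (E a).
Proof. by move=> /(adj_horner_alg (cpx e)); rewrite conj_poly. Qed.

(** Bounds on the norms in the GNS space: [eps] for the error, and [s^-1] for the approximate
    resolvent, as for the exact resolvent at [i * s]. *)
Definition moment_bounds (L : {poly R} -> R) :=
  L (e ^+ 2) <= eps ^+ 2 /\ L (r ^+ 2 * ('X^2 + (s ^+ 2)%:P)) <= s^-1 ^+ 2.

Let normU a L : has_moments a L -> moment_bounds L ->
  nctau (U' a * U a) <= (s^-1 ^+ 2)%:C.
Proof.
move=> mL [_ hL]; rewrite -rmorphM.
have -> : resolvent_poly z * resolvent_poly (- z) =
    cpx (r ^+ 2 * ('X^2 + (s ^+ 2)%:P)).
  rewrite rmorphM rmorphXn /= rmorphD /= map_polyXn map_polyC /=.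
  have -> : (s ^+ 2)%:C = - z ^+ 2 by rewrite sqr_z opprK.
  rewrite /resolvent_poly !rmorphN rmorphXn /=; ring.
by rewrite mL lecR.
Qed.

Let normE a L : has_moments a L -> moment_bounds L ->
  nctau (E a * E a) <= (eps ^+ 2)%:C.
Proof. by move=> mL [hL _]; rewrite -rmorphM -rmorphM -expr2 /= mL lecR. Qed.

Let tauU a L : has_moments a L -> nctau (U a) = - z * (L r)%:C - (L ('X * r))%:C.
Proof.
move=> mL; rewrite /U /resolvent_poly mulrBl rmorphB /= linearB /=; congr (_ - _).
  rewrite (rmorphM (horner_alg a)) /= horner_algC mulr_algl -mL.
  exact: linearZ.
by rewrite -mL (rmorphM cpx) /= map_polyX.
Qed.

(** The centered approximate resolvents are killed as the exact ones are, so
    [boolean_resolvent_identity] applies. Cauchy-Schwarz bounds each of its five error terms by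
    [eps * s^-1 ^+ 2]. *)
Lemma boolean_resolvent_estimate (X Y : ncalg W) (LX LY LS : {poly R} -> R) :
  boolean_independent (val X) (val Y) -> adj X X -> adj Y Y ->
  has_moments X LX -> has_moments Y LY -> has_moments (X + Y) LS ->
  moment_bounds LX -> moment_bounds LY -> moment_bounds LS ->
  LX ('X * r) = 0 -> LY ('X * r) = 0 ->
  `|s ^+ 2 * (LX r * LY r - (LX r + LY r - s ^+ 2 * LX r * LY r) * LS r)|
    <= 5 * eps * s^-1 ^+ 2.
Proof.
move=> ind hX hY mX mY mS bX bY bS oX oY.
have hS := adjD hX hY; set S := X + Y in hS mS.
have ind' : boolean_independent (val Y) (val X).
  by move=> ks hk; have [h1 h2] := ind ks hk; split.
have cX : nctau (horner_alg X (resolvent_poly (- z) - (nctau (U X))%:P)) = 0.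
  rewrite rmorphB /= horner_algC linearB linearZ /= nctau1 /GRing.scale /=.
  by rewrite mulr1 subrr.
have cY : nctau (horner_alg Y (resolvent_poly (- z) - (nctau (U Y))%:P)) = 0.
  rewrite rmorphB /= horner_algC linearB linearZ /= nctau1 /GRing.scale /=.
  by rewrite mulr1 subrr.
have := nctau_mul_centered ind (adjU hS) hX hY cX.
have := nctau_mul_centered ind' (adjU hS) hY hX cY.
rewrite rmorphB /= horner_algC -/(U Y) => hXV.
rewrite rmorphB /= horner_algC -/(U X) => hYU.
have := boolean_resolvent_identity (nctau1 W) (UE X) (UE Y) (UEr S) hYU hXV.
have i0 : 0 <= s^-1 by rewrite invr_ge0 ltW.
have nA a L : adj a a -> has_moments a L -> moment_bounds L ->
    `|nctau (U a)| <= (s^-1)%:C.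
  move=> ha mL bL.
  have := nctau_norm_le (adjU ha) (@adj1 _ W) i0 ler01 (normU mL bL).
  by rewrite !mul1r nctau1 mulr1 expr1n; apply.
have nSE a L : adj a a -> has_moments a L -> moment_bounds L ->
    `|nctau (E S * U a)| <= (s^-1 * eps)%:C.
  move=> ha mL bL.
  exact: nctau_norm_le (adjU ha) (adjE hS) i0 eps_ge0 (normU mL bL) (normE mS bS).
have nUE a L : adj a a -> has_moments a L -> moment_bounds L ->
    `|nctau (U S * E a)| <= (eps * s^-1)%:C.
  move=> ha mL bL.
  apply: nctau_norm_le (adjE ha) (adj_sym (adjU hS)) eps_ge0 i0 (normE mL bL) _.
  by rewrite -rmorphM mulrC rmorphM; exact: normU mS bS.
have nE : `|nctau (E S)| <= eps%:C.
  have := nctau_norm_le (adjE hS) (@adj1 _ W) eps_ge0 ler01 (normE mS bS).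
  by rewrite !mul1r nctau1 mulr1 expr1n; apply.
have nM (x y : R[i]) (p q : R) :
    `|x| <= p%:C -> `|y| <= q%:C -> `|x * y| <= (p * q)%:C.
  by move=> hx hy; rewrite normrM rmorphM ler_pM.
move=> identity.
have : `|nctau (U Y) * nctau (E S * U X) + nctau (U X) * nctau (E S * U Y)
    - nctau (U X) * nctau (U Y) * nctau (E S) - nctau (U Y) * nctau (U S * E X)
    - nctau (U X) * nctau (U S * E Y)| <= (5 * eps * s^-1 ^+ 2)%:C.
  (* One summand for each error term, in the order of the identity. *)
  have -> : 5 * eps * s^-1 ^+ 2 = s^-1 * (s^-1 * eps) + s^-1 * (s^-1 * eps)
      + s^-1 * s^-1 * eps + s^-1 * (eps * s^-1) + s^-1 * (eps * s^-1).
    by ring.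
  have nX := nA _ _ hX mX bX; have nY := nA _ _ hY mY bY.
  rewrite !(rmorphD (real_complex R)) /=.
  apply: le_trans (ler_normB _ _) (lerD _ (nM _ _ _ _ nX (nUE _ _ hY mY bY))).
  apply: le_trans (ler_normB _ _) (lerD _ (nM _ _ _ _ nY (nUE _ _ hX mX bX))).
  apply: le_trans (ler_normB _ _) (lerD _ (nM _ _ _ _ (nM _ _ _ _ nX nY) nE)).
  apply: le_trans (ler_normD _ _) (lerD _ (nM _ _ _ _ nX (nSE _ _ hY mY bY))).
  exact: nM nY (nSE _ _ hX mX bX).
rewrite -identity /= (tauU mX) (tauU mY) (tauU mS) oX oY !subr0.
set a := LX r; set b := LY r; set c := LS r; set d := LS _ => hD.
(* By [oX] and [oY], [tau] takes the values [- z * a] and [- z * b] on the first two resolvents. The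
   contribution of the odd moment [d] of the sum is then purely imaginary, and the real part
   discards it. *)
have := le_trans (normc_ge_Re _) hD; rewrite lecR -normrN.
by congr (`|_| <= _); rewrite /z /=; ring.
Qed.

End ResolventEstimate.

(** * Moments and truncated geometric series *)

Lemma measurable_outside_ball (R : realType) (M : R) :
  measurable ([set x | M <= `|x| ] : set (measurableTypeR R)).
Proof.
rewrite (_ : mkset _ = (fun x : R => `|x|) @^-1` `[M, +oo[%classic).
  rewrite -[X in measurable X]setTI; exact: normr_measurable.
by apply/seteqP; split => x /=; rewrite in_itv /= andbT.
Qed.

Section RealIntegrals.
Context (R : realType) (mu : probability (measurableTypeR R) R).
Local Notation integrable f := (mu.-integrable setT (EFin \o f)).
Implicit Types f g : measurableTypeR R -> R.

(** The polynomial estimates hold on a ball carrying the law, hence the exceptional null set. *)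
Lemma le_Rintegral_conull (N : set (measurableTypeR R)) f g :
  measurable N -> mu N = 0%E -> integrable f -> integrable g ->
  (forall x, ~ N x -> f x <= g x) ->
  \int[mu]_x f x <= \int[mu]_x g x.
Proof.
move=> mN N0 i1 i2 h.
rewrite /Rintegral (negligible_integral mN measurableT i1 N0).
rewrite (negligible_integral mN measurableT i2 N0).
apply: le_Rintegral.
- exact: measurableD.
- by apply: integrableS i1 => //; exact: measurableD.
- by apply: integrableS i2 => //; exact: measurableD.
- by move=> x [_ /h].
Qed.

Lemma Rintegral_probability_cst (c : R) : \int[mu]_x c = c.
Proof. by rewrite Rintegral_cst //= probability_setT mulr1. Qed.

Lemma integrable_probability_cst (c : R) : integrable (fun=> c).
Proof. exact: finite_measure_integrable_cst. Qed.

Lemma integrable_addr f g : integrable f -> integrable g ->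
  integrable (fun x => f x + g x).
Proof. by move=> hf hg; have := integrableD measurableT hf hg. Qed.

Lemma integrable_mulr (c : R) f : integrable f -> integrable (fun x => c * f x).
Proof. by move=> hf; have := integrableZl measurableT c hf. Qed.

(** Reflection preserves [mu] and turns the integral into its opposite. *)
Lemma Rintegral_odd f : symmetric_measure mu -> integrable f ->
  (forall x, f (- x) = - f x) -> \int[mu]_x f x = 0.
Proof.
move=> sym intf oddf.
have mN : measurable_fun setT (-%R : measurableTypeR R -> measurableTypeR R).
  by [].
have /integrableP[mf _] := intf.
have E : (\int[pushforward mu (-%R : measurableTypeR R -> measurableTypeR R)]_x
    (f x)%:E = \int[mu]_x (f x)%:E)%E.
  by apply: eq_measure_integral => A mA _; exact: sym.
have fN : EFin \o f \o -%R = (fun x => (-1)%:E * (f x)%:E)%E.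
  by apply/funext => x /=; rewrite oddf -EFinM mulN1r.
have iN : mu.-integrable (-%R @^-1` setT) (EFin \o f \o -%R).
  by rewrite fN preimage_setT; exact: integrableZl.
rewrite (integral_pushforward mN mf iN measurableT) preimage_setT fN in E.
rewrite integralZl // in E.
have : \int[mu]_x f x = - \int[mu]_x f x.
  rewrite {1}/Rintegral -E fineM //; first by rewrite mulN1r.
  exact: integrable_fin_num.
lra.
Qed.

Section Polynomial.
Hypothesis imom : forall k : nat, mu.-integrable setT (fun x => (x ^+ k)%:E).

Lemma integrable_horner (p : {poly R}) : integrable (fun x => p.[x]).
Proof.
under eq_fun do rewrite horner_coef.
have := @integrable_sum _ _ _ mu setT measurableT _ (index_enum 'I_(size p)) predT
  (fun i x => (p`_i * x ^+ i)%:E).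
rewrite (_ : (fun x => _) = (fun x => (\sum_(i < size p) p`_i * x ^+ i)%:E)).
  by apply => i _; exact: (integrable_mulr p`_i (imom i)).
by apply/funext => x; rewrite sumEFin.
Qed.

Definition moment_functional (p : {poly R}) : R := \int[mu]_x p.[x].

Lemma moment_functionalD p q :
  moment_functional (p + q) = moment_functional p + moment_functional q.
Proof.
rewrite /moment_functional -RintegralD //; try exact: integrable_horner.
by apply: eq_Rintegral => x _; rewrite hornerD.
Qed.

Lemma moment_functionalZ (c : R) p :
  moment_functional (c *: p) = c * moment_functional p.
Proof.
rewrite /moment_functional -RintegralZl //; last exact: integrable_horner.
by apply: eq_Rintegral => x _; rewrite hornerZ.
Qed.

Lemma moment_functionalE p :
  moment_functional p = \sum_(i < size p) p`_i * \int[mu]_x (x ^+ i).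
Proof.
have L0 : moment_functional 0 = 0.
  by rewrite -(scale0r (0 : {poly R})) moment_functionalZ mul0r.
rewrite -{1}[p]coefK poly_def (big_morph _ moment_functionalD L0).
apply: eq_bigr => i _; rewrite moment_functionalZ; congr (_ * _).
by apply: eq_Rintegral => x _; rewrite hornerXn.
Qed.

(** Markov's inequality for [x ^+ (2 * k)] bounds the mass by [(m / (m + 1)) ^+ (2 * k)], which
    tends to 0. *)
Lemma null_outside_ball (m : R) : 0 <= m ->
  (forall k, \int[mu]_x (x ^+ (2 * k)) <= m ^+ (2 * k)) ->
  mu [set x | m + 1 <= `|x| ] = 0%E.
Proof.
move=> m0 hm; set N := [set x | _].
have mN : measurable (N : set (measurableTypeR R)) by exact: measurable_outside_ball.
have M0 : 0 < m + 1 by lra.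
set q := fine (mu N).
have hq k : q <= ((m / (m + 1)) ^+ 2) ^+ k.
  rewrite -exprM expr_div_n ler_pdivlMr ?exprn_gt0 // mulrC.
  apply: le_trans (hm k).
  have i1 : integrable (\1_N : measurableTypeR R -> R) by exact: integrable_indic.
  have -> : q = \int[mu]_x \1_N x by rewrite /Rintegral integral_indic ?setIT.
  rewrite -RintegralZl //; apply: le_Rintegral; first exact: measurableT.
  - exact: (integrable_mulr _ i1).
  - exact: imom.
  move=> x _; rewrite indicE.
  have [/set_mem Nx|_] := boolP (x \in N); rewrite ?mulr1 ?mulr0.
    rewrite -[leRHS]ger0_norm ?exprn_even_ge0 ?oddM // normrX.
    by rewrite lerXn2r ?nnegrE ?(ltW M0).
  by rewrite exprn_even_ge0 ?oddM.
have q0 : q <= 0.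
  have c : ((m / (m + 1)) ^+ 2) ^+ k @[k --> \oo] --> 0.
    apply: cvg_expr; rewrite ger0_norm ?exprn_ge0 ?divr_ge0 // ?ltW //.
    by rewrite exprn_ilt1 // ?divr_ge0 ?ltr_pdivrMr ?mul1r ?ltrDl // ltW.
  by apply: (cvgr_to_ge c); exact: nearW.
have : 0 <= q by rewrite fine_ge0.
rewrite -[mu N]fineK ?fin_num_measure // -/q => q1.
by congr EFin; apply/le_anti; rewrite q0.
Qed.

End Polynomial.

End RealIntegrals.

(** For symmetric [mu], the Cauchy transform at [i * sqrt t] is [- i * sqrt t] times this number. *)
Definition square_stieltjes (R : realType) (mu : probability (measurableTypeR R) R)
  (t : R) : R := \int[mu]_x (x ^+ 2 + t)^-1.

Lemma measurable_inv_sqrD (R : realType) (t : R) : 0 < t ->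
  measurable_fun setT (fun x : measurableTypeR R => (x ^+ 2 + t)^-1).
Proof.
move=> t0; apply: continuous_measurable_fun => x.
apply: cvgV; first by rewrite gt_eqF // ltr_wpDl ?sqr_ge0.
by apply: cvgD; [exact: exprn_continuous|exact: cvg_cst].
Qed.

Lemma integrable_inv_sqrD (R : realType) (mu : probability (measurableTypeR R) R)
    (t : R) : 0 < t ->
  mu.-integrable setT (EFin \o (fun x : measurableTypeR R => (x ^+ 2 + t)^-1)).
Proof.
move=> t0.
apply: (le_integrable measurableT _ _ (integrable_probability_cst mu t^-1)).
  apply/measurable_EFinP; exact: measurable_inv_sqrD.
move=> x _ /=; have x0 : 0 < x ^+ 2 + t by rewrite ltr_wpDl ?sqr_ge0.
rewrite lee_fin !ger0_norm ?invr_ge0 ?(ltW t0) ?(ltW x0) //.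
by rewrite lef_pV2 ?posrE // lerDr sqr_ge0.
Qed.

(** * Truncated geometric series for [1 / (x ^+ 2 + t)] *)

Section GeometricResolvent.
Context (R : realType).
Variables (s K M : R).
Local Notation t := (s ^+ 2).
Hypotheses (s_gt0 : 0 < s) (M_ge0 : 0 <= M) (MK : M ^+ 2 + t <= K).

(** With [v = x ^+ 2 + t], the expansion is that of [1 / v] as [K^-1] times the sum of the powers of
    [1 - v / K]. On the ball of radius [M] one has [t <= v <= K], so the ratio lies between 0 and
    its value [1 - t / K] at [x = 0]. *)
Definition geo_ratio : {poly R} := 1 - K^-1 *: ('X^2 + t%:P).
Definition geo_error n := geo_ratio ^+ n.
Definition geo_inverse n := K^-1 *: \sum_(i < n) geo_ratio ^+ i.

Let t_gt0 : 0 < t. Proof. by rewrite exprn_gt0. Qed.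
Let K_gt0 : 0 < K.
Proof. by apply: lt_le_trans MK; rewrite ltr_wpDl ?sqr_ge0. Qed.

Lemma geo_inverseE n : ('X^2 + t%:P) * geo_inverse n = 1 - geo_error n.
Proof.
rewrite /geo_error -[RHS]opprB subrX1 /geo_inverse -scalerAr scalerAl.
by rewrite -mulNr opprB /geo_ratio subKr.
Qed.

Definition geo_rate := 1 - t / K.

Lemma geo_rate_ge0 : 0 <= geo_rate.
Proof.
by rewrite subr_ge0 ler_pdivrMr // mul1r; apply: le_trans MK; rewrite lerDr sqr_ge0.
Qed.

Lemma geo_rate_lt1 : geo_rate < 1.
Proof. by rewrite gtrDl oppr_lt0 divr_gt0. Qed.

Lemma geo_error_bounds n x : `|x| <= M -> 0 <= (geo_error n).[x] <= geo_rate ^+ n.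
Proof.
move=> xM; have x2 : x ^+ 2 <= M ^+ 2.
  by rewrite -real_normK ?num_real // lerXn2r ?nnegrE.
have h0 : 0 <= geo_ratio.[x].
  rewrite !hornerE subr_ge0 mulrC ler_pdivrMr // mul1r.
  by apply: le_trans MK; rewrite lerD2r.
rewrite horner_exp exprn_ge0 //= lerXn2r ?nnegrE ?geo_rate_ge0 //.
rewrite !hornerE lerD2l lerN2 [K^-1 * _]mulrC.
by rewrite ler_pM2r ?invr_gt0 // lerDr sqr_ge0.
Qed.

Lemma horner_geo_inverse n x :
  (geo_inverse n).[x] = (1 - (geo_error n).[x]) / (x ^+ 2 + t).
Proof.
have /(congr1 (horner^~ x)) := geo_inverseE n.
rewrite hornerM !hornerD hornerN hornerXn !hornerC => <-.
by rewrite mulrC mulKf // gt_eqF // ltr_wpDl ?sqr_ge0.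
Qed.

Lemma horner_geo_inverseN n x : (geo_inverse n).[- x] = (geo_inverse n).[x].
Proof.
by rewrite !horner_geo_inverse !horner_exp !hornerE sqrrN.
Qed.

Variable (mu : probability (measurableTypeR R) R).
Hypothesis imom : forall k : nat, mu.-integrable setT (fun x => (x ^+ k)%:E).
Hypothesis muM : mu [set x | M <= `|x| ] = 0%E.
Local Notation L := (moment_functional mu).

Let mM := measurable_outside_ball M.

Let lt_M (x : R) : ~ (M <= `|x|) -> `|x| <= M.
Proof. by move/negP; rewrite -ltNge => /ltW. Qed.

Let pos (x : R) : 0 < x ^+ 2 + t.
Proof. by rewrite ltr_wpDl ?sqr_ge0. Qed.

(** On the ball the error [e] lies in [0, 1], so [r ^+ 2 * (x ^+ 2 + t)], which is
    [(1 - e) ^+ 2 / (x ^+ 2 + t)], is at most [t^-1]. *)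
Lemma geo_moment_bounds n :
  moment_bounds s (geo_rate ^+ n) (geo_inverse n) (geo_error n) L.
Proof.
split.
  rewrite -[leRHS](Rintegral_probability_cst mu).
  apply: (le_Rintegral_conull mM muM (integrable_horner imom _)
  (integrable_probability_cst _ _)).
  move=> x /lt_M /(geo_error_bounds n)/andP[h0 h1].
  by rewrite horner_exp lerXn2r ?nnegrE ?exprn_ge0 ?geo_rate_ge0.
rewrite -[leRHS](Rintegral_probability_cst mu).
apply: (le_Rintegral_conull mM muM (integrable_horner imom _)
  (integrable_probability_cst _ _)).
move=> x /lt_M /(geo_error_bounds n)/andP[h0 h1].
have h2 : (geo_error n).[x] <= 1.
  by apply: le_trans h1 _; rewrite exprn_ile1 ?geo_rate_ge0 ?ltW ?geo_rate_lt1.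
rewrite hornerM horner_exp horner_geo_inverse hornerD hornerXn hornerC.
set e := (geo_error n).[x] in h0 h1 h2 *; set v := x ^+ 2 + t.
have v0 : v != 0 by rewrite gt_eqF ?pos.
have -> : ((1 - e) / v) ^+ 2 * v = (1 - e) * (1 - e) / v by field.
rewrite exprVn -[leRHS]mul1r ler_pM ?mulr_ge0 ?subr_ge0 ?invr_ge0 ?(ltW (pos x)) //.
  by rewrite mulr_ile1 ?subr_ge0 // gerBl.
by rewrite lef_pV2 ?posrE ?pos // /v lerDr sqr_ge0.
Qed.

Lemma geo_moment_cvg n :
  `|L (geo_inverse n) - square_stieltjes mu t| <= geo_rate ^+ n / t.
Proof.
have ii := integrable_inv_sqrD mu t_gt0.
have ic := integrable_probability_cst mu (geo_rate ^+ n / t).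
have ir := integrable_horner imom (geo_inverse n).
have E x : (geo_inverse n).[x] = (x ^+ 2 + t)^-1 - (geo_error n).[x] / (x ^+ 2 + t).
  by rewrite horner_geo_inverse mulrBl mul1r.
have B x : ~ (M <= `|x|) ->
    0 <= (geo_error n).[x] / (x ^+ 2 + t) <= geo_rate ^+ n / t.
  move=> /lt_M /(geo_error_bounds n)/andP[h0 h1].
  rewrite divr_ge0 ?(ltW (pos x)) //= ler_pM // ?invr_ge0 ?(ltW (pos x)) //.
  by rewrite lef_pV2 ?posrE // lerDr sqr_ge0.
have c0 : 0 <= geo_rate ^+ n / t by rewrite divr_ge0 ?exprn_ge0 ?geo_rate_ge0 ?ltW.
have h1 : square_stieltjes mu t <= L (geo_inverse n) + geo_rate ^+ n / t.
  have := @le_Rintegral_conull _ mu _ _ _ mM muM ii (integrable_addr ir ic).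
  rewrite RintegralD // Rintegral_probability_cst; apply.
  by move=> x /B /andP[h0 h1]; rewrite E; lra.
have h2 : L (geo_inverse n) <= square_stieltjes mu t + geo_rate ^+ n / t.
  have := @le_Rintegral_conull _ mu _ _ _ mM muM ir (integrable_addr ii ic).
  rewrite RintegralD // Rintegral_probability_cst; apply.
  by move=> x /B /andP[h0 h2]; rewrite E; lra.
by rewrite ler_norml; apply/andP; split; lra.
Qed.

Lemma geo_moment_odd n : symmetric_measure mu -> L ('X * geo_inverse n) = 0.
Proof.
move=> sym; apply: Rintegral_odd => //; first exact: integrable_horner.
by move=> x; rewrite !hornerM !hornerX horner_geo_inverseN mulNr.
Qed.

End GeometricResolvent.

(** * The Stieltjes transform of a Boolean convolution *)

Lemma cvg_geometric_bound (R : realType) (u : R ^nat) (l C q : R) :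
  0 <= q -> q < 1 -> (forall n, `|u n - l| <= C * q ^+ n) -> u n @[n --> \oo] --> l.
Proof.
move=> q0 q1 h; apply/subr_cvg0.
apply: norm_cvg0; apply: (@squeeze_cvgr _ _ _ _ (fun=> 0) (fun n => C * q ^+ n)).
- by apply: nearW => n; rewrite normr_ge0 h.
- exact: cvg_cst.
rewrite -(mulr0 C); apply: cvgM; first exact: cvg_cst.
by apply: cvg_expr; rewrite ger0_norm.
Qed.

Lemma null_ball_mono (R : realType) (mu : probability (measurableTypeR R) R)
    (m M : R) :
  m <= M -> mu [set x | m <= `|x| ] = 0%E -> mu [set x | M <= `|x| ] = 0%E.
Proof.
move=> mM; apply: subset_measure0; try exact: measurable_outside_ball.
by move=> x /=; exact: le_trans.
Qed.

Section Law.
Context (R : realType) (W : ncProbSpace R).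

Lemma nc_op_bounded (a : ncalg W) :
  exists2 m : R, 0 <= m & forall x, `|val a x| <= m%:C * `|x|.
Proof.
have [_ ca] := vna_bounded (nc_algP W) (ncalgP a).
pose f : {linear nc_hilbert W -> nc_hilbert W} :=
  HB.pack (val a) (GRing.isLinear.Build _ _ _ _ (val a) (@nc_op_linear _ _ a)).
have /linear_boundedP/pinfty_ex_gt0[m m0 hm] : bounded_near f (nbhs 0).
  by apply/linear_bounded_continuous.
(* The bound [m] is a positive element of [R[i]], hence real. *)
exists (complex.Re m); first by move: m0; rewrite ltcE /= => /andP[_ /ltW].
by move=> x; have := hm x; rewrite RRe_real ?gtr0_real.
Qed.

(* Normality, applied to the two-element directed set [{a, b}], replaces the
   square root of [b - a] in the usual proof of monotonicity. *)
Lemma nctau_le (a b : ncalg W) : adj a a -> adj b b -> op_le (val a) (val b) ->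
  nctau a <= nctau b.
Proof.
move=> ha hb ab; pose D : set 'op(W) := [set val a; val b].
have lexx' (A : 'op(W)) : op_le A A.
  by move=> x; rewrite subrr linear0l.
have leb A : D A -> op_le A (val b) by case=> ->.
have DM A : D A -> nc_alg A /\ self_adjoint A.
  by case=> ->; split => //; exact: ncalgP.
have sup : op_supremum (@nc_alg _ W) D (val b).
  split; first by split; [exact: ncalgP|exact: hb].
    exact: leb.
  by move=> T _ _; apply; right.
have [ub _] := nc_normal (ex_intro _ (val a) (or_introl erefl)) DM
  (fun A B dA dB =>
    ex_intro _ (val b) (And3 (or_intror erefl) (leb A dA) (leb B dB))) sup.
by apply: ub; exists (val a) => //; left.
Qed.

Lemma adj_exp (a : ncalg W) k : adj a a -> adj (a ^+ k) (a ^+ k).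
Proof.
move=> ha; elim: k => [|k IH]; first by rewrite expr0; exact: adj1.
by rewrite {1}exprS exprSr; exact: adjM.
Qed.

(** For self-adjoint [a], pairing [a ^+ (2 * k)] at [x] gives the squared norm of [a ^+ k] at [x];
    hence [a ^+ (2 * k)] is below [m ^+ (2 * k)] in the operator order, and [nctau_le] concludes. *)
Lemma nctau_even_moment (a : ncalg W) (m : R) : adj a a -> 0 <= m ->
  (forall x, `|val a x| <= m%:C * `|x|) ->
  forall k, nctau (a ^+ (2 * k)) <= (m ^+ (2 * k))%:C.
Proof.
move=> ha m0 hm k.
have hk : forall x, `|val (a ^+ k) x| <= (m ^+ k)%:C * `|x|.
  elim: k => [|k IH] x; first by rewrite !expr0 (rmorph1 (real_complex R)) mul1r.
  rewrite exprS (_ : val (a * a ^+ k) x = val a (val (a ^+ k) x)) //.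
  apply: le_trans (hm _) _; rewrite exprS rmorphM /= -mulrA.
  apply: ler_wpM2l (IH x); rewrite ler0c //.
set c := leRHS.
have -> : c = nctau (c *: (1 : ncalg W)).
  by rewrite linearZ /= nctau1 /GRing.scale /= mulr1.
apply: nctau_le; first exact: adj_exp.
  by have := adjZ c (@adj1 _ W); rewrite (_ : c^* = c) //; exact: conjc_real.
move=> x; rewrite linearBl subr_ge0.
have -> : val (c *: (1 : ncalg W)) x = c *: x by [].
have -> : val (a ^+ (2 * k)) x = val (a ^+ k) (val (a ^+ k) x).
  by rewrite mul2n -addnn exprD.
have -> : c = (m ^+ k)%:C ^+ 2 by rewrite /c mulnC exprM rmorphXn.
rewrite [leLHS](_ : _ = '[| val (a ^+ k) x, val (a ^+ k) x |]); last exact: adj_exp.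
rewrite linearZl_LR /= -!hdot_norm -exprMn.
have mk0 : 0 <= (m ^+ k)%:C by rewrite ler0c exprn_ge0.
by apply: lerXn2r; rewrite ?nnegrE ?mulr_ge0 //; exact: hk.
Qed.

Lemma has_moments_law (a : ncalg W) mu : is_law (val a) mu ->
  has_moments a (moment_functional mu).
Proof.
move=> la p.
have imom k : mu.-integrable setT (fun x => (x ^+ k)%:E) by case: (la k).
rewrite horner_algE linear_sum (moment_functionalE imom) rmorph_sum size_map_poly.
refine (eq_bigr _ _) => i _; rewrite coef_map linearZ rmorphM; congr (_ * _).
by have [_ h] := la i; apply: etrans h; rewrite /= /nctau val_ncexp.
Qed.

Lemma law_null_outside_ball (a : ncalg W) mu : adj a a -> is_law (val a) mu ->
  exists2 m : R, 0 <= m & mu [set x | m <= `|x| ] = 0%E.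
Proof.
move=> ha la; have [m m0 hm] := nc_op_bounded a.
exists (m + 1); first by rewrite addr_ge0.
apply: null_outside_ball => // k; first by case: (la k).
have := nctau_even_moment ha m0 hm k.
have [_ h] := la (2 * k)%N.
by rewrite /nctau val_ncexp -/(op_pow _ _) h lecR.
Qed.

(** The quantity in [boolean_resolvent_estimate], along the geometric approximations at
    [s = sqrt t], tends both to its value at the three transforms and to 0. *)
Lemma square_stieltjes_boolean (X Y : ncalg W) muX muY muXY (t : R) :
  adj X X -> adj Y Y ->
  is_law (val X) muX -> is_law (val Y) muY -> is_law (val (X + Y)) muXY ->
  symmetric_measure muX -> symmetric_measure muY ->
  boolean_independent (val X) (val Y) -> 0 < t ->
  let a := square_stieltjes muX t in let b := square_stieltjes muY t in
  a * b = (a + b - t * a * b) * square_stieltjes muXY t.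
Proof.
move=> hX hY lX lY lXY sX sY ind t0 a b; set c := square_stieltjes muXY t.
have hS := adjD hX hY.
have [mX mX0 nX] := law_null_outside_ball hX lX.
have [mY mY0 nY] := law_null_outside_ball hY lY.
have [mS mS0 nS] := law_null_outside_ball hS lXY.
pose s := Num.sqrt t; have st : s ^+ 2 = t by rewrite sqr_sqrtr ?ltW.
have s0 : 0 < s by rewrite sqrtr_gt0.
(* The estimate takes one polynomial [r] for all three laws, so they need a common radius. *)
pose M := mX + mY + mS; have M0 : 0 <= M by rewrite !addr_ge0.
pose K := M ^+ 2 + s ^+ 2; pose rho := geo_rate s K.
have rho0 : 0 <= rho by exact: geo_rate_ge0 (lexx K).
have rho1 : rho < 1 by exact: geo_rate_lt1 (lexx K).
have nXM : muX [set x | M <= `|x| ] = 0%E.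
  by apply: null_ball_mono nX; rewrite /M -addrA lerDl addr_ge0.
have nYM : muY [set x | M <= `|x| ] = 0%E.
  by apply: null_ball_mono nY; rewrite /M addrAC lerDr addr_ge0.
have nSM : muXY [set x | M <= `|x| ] = 0%E.
  by apply: null_ball_mono nS; rewrite /M lerDr addr_ge0.
have iX k : muX.-integrable setT (fun x => (x ^+ k)%:E) by case: (lX k).
have iY k : muY.-integrable setT (fun x => (x ^+ k)%:E) by case: (lY k).
have iS k : muXY.-integrable setT (fun x => (x ^+ k)%:E) by case: (lXY k).
pose r := geo_inverse s K.
have cvgL (mu : probability (measurableTypeR R) R) :
    (forall k : nat, mu.-integrable setT (fun x => (x ^+ k)%:E)) ->
    mu [set x | M <= `|x| ] = 0%E ->
    moment_functional mu (r n) @[n --> \oo] --> square_stieltjes mu t.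
  move=> imu nmu; apply: (cvg_geometric_bound (C := t^-1) rho0 rho1) => n.
  rewrite -st [leRHS]mulrC.
  exact: (geo_moment_cvg s0 M0 (lexx K) imu nmu n).
have cX := cvgL _ iX nXM; have cY := cvgL _ iY nYM; have cS := cvgL _ iS nSM.
pose F (u v w : R) := s ^+ 2 * (u * v - (u + v - s ^+ 2 * u * v) * w).
pose u n := F (moment_functional muX (r n)) (moment_functional muY (r n))
  (moment_functional muXY (r n)).
have cF : u n @[n --> \oo] --> F a b c.
  apply: cvgM; first exact: cvg_cst.
  apply: cvgB; first exact: cvgM.
  apply: cvgM => //; apply: cvgB; first exact: cvgD.
  by apply: cvgM => //; apply: cvgM => //; exact: cvg_cst.
have c0 : u n @[n --> \oo] --> 0.
  apply: (cvg_geometric_bound (C := 5 * s^-1 ^+ 2) rho0 rho1) => n.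
  rewrite subr0 [leRHS]mulrAC.
  have rn0 : 0 <= rho ^+ n by rewrite exprn_ge0.
  exact: (boolean_resolvent_estimate s0 rn0 (geo_inverseE s K n) ind hX hY
    (has_moments_law lX) (has_moments_law lY) (has_moments_law lXY)
    (geo_moment_bounds s0 M0 (lexx K) iX nXM n)
    (geo_moment_bounds s0 M0 (lexx K) iY nYM n)
    (geo_moment_bounds s0 M0 (lexx K) iS nSM n)
    (geo_moment_odd K s0 iX n sX)
    (geo_moment_odd K s0 iY n sY)).
have /eqP : F a b c = 0 by rewrite -(cvg_lim _ cF) // (cvg_lim _ c0).
by rewrite /F mulf_eq0 sqrf_eq0 gt_eqF //= st subr_eq0 => /eqP.
Qed.

End Law.

(** * The Fisher kernel as an integral *)

Section FisherKernel.
Context (R : realType).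
Local Notation leb := (@lebesgue_measure R).

(** The reciprocal of the logarithmic mean of [u] and [v]. *)
Definition log_mean_kernel (u v : R) : R :=
  if u == v then u^-1 else (ln u - ln v) / (u - v).

Let cvg_inv_affine (l v : R) : 0 < l -> 0 < v ->
  (v + l * t)^-1 @[t --> +oo%R] --> (0 : R).
Proof.
move=> l0 v0; apply/gtr0_cvgV0.
  near=> t; have t0 : 0 < t by near: t; apply: nbhs_pinfty_gt; exact: num_real.
  by rewrite addr_gt0 ?mulr_gt0.
apply/cvgryPge => A; near=> t.
have tA : A / l <= t by near: t; apply: nbhs_pinfty_ge; exact: num_real.
have : A <= l * t by rewrite mulrC -ler_pdivrMr.
lra.
Unshelve. all: by end_near. Qed.

Let is_derive_affine (l v t : R) : is_derive t 1 (fun t => v + l * t) l.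
Proof.
have h : is_derive t (1 : R) (cst v + l \*: id) (0 + l *: 1) by exact: is_deriveD.
by rewrite add0r /GRing.scale /= mulr1 in h.
Qed.

Let is_derive_ln_affine (l v t : R) : 0 < v + l * t ->
  is_derive t 1 (fun t => ln (v + l * t)) ((v + l * t)^-1 * l).
Proof.
move=> h; have h1 := is_derive1_ln h.
have h2 := is_derive_affine l v t.
exact (@is_derive1_comp R (@ln R) (fun t => v + l * t) t _ _ h1 h2).
Qed.

(** An explicit antiderivative is evaluated at 0 and at infinity. Carrying the scale [l] from here
    on replaces a later substitution in [t]. *)
Lemma integral_inv_affine2 (l u v : R) : 0 < l -> 0 < u -> 0 < v ->
  (\int[leb]_(t in `]0%R, +oo[) (((u + l * t) * (v + l * t))^-1)%:E =
   (l^-1 * log_mean_kernel u v)%:E)%E.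
Proof.
move=> l0 u0 v0.
have pos (w t : R) : 0 < w -> 0 <= t -> 0 < w + l * t.
  by move=> w0 t0; rewrite ltr_pwDl // mulr_ge0 // ltW.
pose f t := ((u + l * t) * (v + l * t))^-1.
have fcont t : 0 <= t -> {for t, continuous f}.
  move=> t0; apply: cvgV; first by rewrite gt_eqF // mulr_gt0 ?pos.
  by apply: cvgM; apply: cvgD; do ?exact: cvg_cst; apply: cvgM;
    do ?exact: cvg_cst; exact: cvg_id.
have mf : measurable_fun (`]0%R, +oo[%classic : set (measurableTypeR R))
    (fun t : measurableTypeR R => (f t)%:E).
  apply/measurable_EFinP; apply: open_continuous_measurable_fun.
    exact: interval_open.
  by move=> t; rewrite inE /= in_itv /= andbT => /ltW/fcont.
have FTC (F : R -> R) (l' : R) : F t @[t --> +oo%R] --> l' ->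
    (forall t : R, 0 <= t -> is_derive t (1 : R) F (f t)) ->
    (\int[leb]_(t in `]0%R, +oo[) (f t)%:E = l'%:E - (F 0)%:E)%E.
  move=> cF dF; rewrite integral_itv_obnd_cbnd //.
  apply: ge0_continuous_FTC2y => //.
  - by move=> t t0; rewrite invr_ge0 mulr_ge0 ?ltW ?pos.
  - apply: continuous_in_subspaceT => t; rewrite inE /= in_itv /= andbT.
    exact: fcont.
  - by move=> t /ltW/dF[].
  - apply: cvg_at_right_filter; apply: differentiable_continuous.
    by apply/derivable1_diffP; case: (dF 0 (lexx 0)).
  - move=> t; rewrite in_itv /= andbT derive1E => /ltW/dF h; exact: derive_val.
rewrite /log_mean_kernel; have [uv|uv] := eqVneq u v.
  apply: etrans (FTC (fun t => - l^-1 * (u + l * t)^-1) 0 _ _) _; last first.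
  - by rewrite mulr0 addr0 sub0e mulNr -EFinN opprK.
  - move=> t t0; have hu := pos _ _ u0 t0.
    have hu0 : u + l * t != 0 by rewrite gt_eqF.
    have h := is_deriveZ (- l^-1) 
      (is_deriveV (f := fun t => u + l * t) (x := t) hu0 (is_derive_affine l u t)).
    rewrite (_ : f t = - l^-1 *: (- (u + l * t) ^- 2 *: l)); first exact: h.
    by rewrite /f /GRing.scale /= -uv; field; rewrite hu0 gt_eqF.
  by rewrite -(mulr0 (- l^-1)); apply: cvgM; [exact: cvg_cst|exact: cvg_inv_affine].
have vu0 : v - u != 0 by rewrite subr_eq0 eq_sym.
have uv0 : u - v != 0 by rewrite subr_eq0.
have ln0 := gt_eqF l0.
(* Partial fractions, with [1 / (v - u)] as coefficient. *)
pose F t := (l * (v - u))^-1 * (ln (u + l * t) - ln (v + l * t)).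
apply: etrans (FTC F 0 _ _) _; rewrite /F; last first.
- rewrite !mulr0 !addr0 sub0e -EFinN; congr EFin; field.
  by rewrite ln0 vu0 uv0.
- move=> t t0; have hu := pos _ _ u0 t0; have hv := pos _ _ v0 t0.
  have hu0 : u + l * t != 0 by rewrite gt_eqF.
  have hv0 : v + l * t != 0 by rewrite gt_eqF.
  have h := is_deriveZ (l * (v - u))^-1
    (is_deriveB (is_derive_ln_affine hu) (is_derive_ln_affine hv)).
  rewrite (_ : f t = (l * (v - u))^-1 *: ((u + l * t)^-1 * l - (v + l * t)^-1 * l)).
    exact: h.
  rewrite /f /GRing.scale /=; field.
  by rewrite ln0 vu0 hu0 hv0.
(* Each logarithm diverges, but their difference is [ln (1 + (u - v) / (v + l * t))], which tends to
   [ln 1]. *)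
rewrite -(mulr0 (l * (v - u))^-1); apply: cvgM; first exact: cvg_cst.
have c1 : (1 + (u - v) * (v + l * t)^-1) @[t --> +oo%R] --> (1 + (u - v) * 0 : R).
  apply: cvgD; first exact: cvg_cst.
  by apply: cvgM; [exact: cvg_cst|exact: cvg_inv_affine].
rewrite mulr0 addr0 in c1.
have c2 := continuous_cvg _ (continuous_ln ltr01) c1.
rewrite ln1 in c2.
have c3 : (fun t => ln (1 + (u - v) * (v + l * t)^-1)) @ +oo%R --> (0 : R).
  exact: c2.
apply: cvg_trans c3; apply: near_eq_cvg.
near=> t; have t0 : 0 <= t by near: t; apply: nbhs_pinfty_ge; exact: num_real.
have hu := pos _ _ u0 t0; have hv := pos _ _ v0 t0.
rewrite -ln_div ?posrE //; congr ln; field.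
by rewrite gt_eqF.
Unshelve. all: by end_near. Qed.

(** The divergence is at [t = 0]. The vanishing parameter is raised to a small [e > 0] and the other
    one to [M]; this decreases the integral to a value given by [integral_inv_affine2]. *)
Lemma integral_inv_affine2_zero (l u v : R) : 0 < l -> 0 <= u -> 0 <= v ->
  (u == 0) || (v == 0) ->
  (\int[leb]_(t in `]0%R, +oo[) (((u + l * t) * (v + l * t))^-1)%:E = +oo)%E.
Proof.
move=> l0 u0 v0 uv0; apply/eqyP => A A0.
pose M := u + v + 1; have M1 : 1 <= M by rewrite lerDr addr_ge0.
have M0 : 0 < M by apply: lt_le_trans M1.
have AMl0 : 0 < A * M * l by rewrite !mulr_gt0.
(* As [ln M >= 0], the value [l^-1 * (ln M - ln e) / (M - e)] is at least [A * M / (M - e)], hence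
   at least [A]. *)
pose e := expR (- (A * M * l)); have e0 : 0 < e by exact: expR_gt0.
have e1 : e < 1 by rewrite expR_lt1 oppr_lt0.
have pos (w t : R) : 0 <= w -> 0 < t -> 0 < w + l * t.
  by move=> w0 t0; rewrite ltr_wpDl // mulr_gt0.
have mf (w w' : R) : 0 <= w -> 0 <= w' ->
    measurable_fun (`]0%R, +oo[%classic : set (measurableTypeR R))
    (fun t : measurableTypeR R => (((w + l * t) * (w' + l * t))^-1)%:E).
  move=> w0 w0'; apply/measurable_EFinP; apply: open_continuous_measurable_fun.
    exact: interval_open.
  move=> t; rewrite inE /= in_itv /= andbT => t0.
  apply: cvgV; first by rewrite gt_eqF // mulr_gt0 ?pos.
  by apply: cvgM; apply: cvgD; do ?exact: cvg_cst; apply: cvgM;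
    do ?exact: cvg_cst; exact: cvg_id.
have : (\int[leb]_(t in `]0%R, +oo[) (((e + l * t) * (M + l * t))^-1)%:E <=
    \int[leb]_(t in `]0%R, +oo[) (((u + l * t) * (v + l * t))^-1)%:E)%E.
  apply: ge0_le_integral => //.
  - move=> t; rewrite /= in_itv /= andbT => t0.
    by rewrite lee_fin invr_ge0 mulr_ge0 ?ltW ?pos // ltW.
  - by apply: mf; exact: ltW.
  - exact: mf.
  - move=> t; rewrite /= in_itv /= andbT => t0.
    have h (w : R) : 0 <= w -> 0 < w + l * t by move=> w0; exact: pos.
    have [he hM] := (h e (ltW e0), h M (ltW M0)).
    have huv := mulr_gt0 (h _ u0) (h _ v0).
    rewrite lee_fin lef_pV2 ?posrE ?(mulr_gt0 he hM) ?huv //.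
    have lt0 : 0 < l * t by rewrite mulr_gt0.
    have [w [/andP[w0 wM] ->]] : exists w, 0 <= w <= M /\
        (u + l * t) * (v + l * t) = l * t * (w + l * t).
      by case/orP: uv0 => /eqP ->; [exists v|exists u]; split;
        rewrite ?add0r // 1?mulrC // /M; lra.
    apply: ler_pM; rewrite ?(ltW lt0) ?lerDr ?(ltW e0) ?lerD2r //; lra.
apply: le_trans; rewrite integral_inv_affine2 // lee_fin.
rewrite /log_mean_kernel lt_eqF; last lra.
have Me : 0 < M - e by lra.
have -> : (ln e - ln M) / (e - M) = (A * M * l + ln M) / (M - e).
  by rewrite expRK; field; rewrite !subr_eq0 gt_eqF ?lt_eqF //; lra.
rewrite mulrA ler_pdivlMr //.
have -> : l^-1 * (A * M * l + ln M) = A * M + l^-1 * ln M by field; rewrite gt_eqF.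
have : 0 <= l^-1 * ln M by rewrite mulr_ge0 ?invr_ge0 ?ln_ge0 // ltW.
have : 0 < A * e by rewrite mulr_gt0.
lra.
Qed.

Lemma integral_fisher_kernel (l x y : R) : 0 < l ->
  (\int[leb]_(t in `]0%R, +oo[) (((x ^+ 2 + l * t) * (y ^+ 2 + l * t))^-1)%:E =
   l^-1%:E * fisher_kernel x y)%E.
Proof.
move=> l0; rewrite /fisher_kernel.
have [xy|xy] := boolP ((x == 0) || (y == 0)).
  rewrite integral_inv_affine2_zero ?sqr_ge0 ?sqrf_eq0 //.
  by rewrite gt0_muley // lte_fin invr_gt0.
move: xy; rewrite negb_or => /andP[x0 y0].
rewrite integral_inv_affine2 ?exprn_even_gt0 // EFinM /log_mean_kernel.
by case: ifP.
Qed.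

End FisherKernel.

(** * Estimates on the transform, and the information as the integral of its square *)

Section SquareStieltjes.
Context (R : realType) (mu : probability (measurableTypeR R) R).
Local Notation leb := (@lebesgue_measure R).
Local Notation g := (square_stieltjes mu).

Lemma square_stieltjes_le t : 0 < t -> g t <= t^-1.
Proof.
move=> t0; rewrite -[leRHS](Rintegral_probability_cst mu).
apply: le_Rintegral; first exact: measurableT.
- exact: integrable_inv_sqrD.
- exact: integrable_probability_cst.
by move=> x _; rewrite lef_pV2 ?posrE ?ltr_wpDl ?sqr_ge0 // lerDr sqr_ge0.
Qed.

Lemma square_stieltjes_gt0 t : 0 < t -> 0 < g t.
Proof.
move=> t0; have ii := integrable_inv_sqrD mu t0.
have pos (x : R) : 0 < x ^+ 2 + t by rewrite ltr_wpDl ?sqr_ge0.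
rewrite lt_def Rintegral_ge0 ?andbT; last by move=> x _; rewrite invr_ge0 ltW.
apply/eqP => g0.
have /integrableP[mi _] := ii.
have : (\int[mu]_x `|((x ^+ 2 + t)^-1)%:E| = 0)%E.
  under eq_integral do rewrite gee0_abs ?lee_fin ?invr_ge0 ?(ltW (pos _)) //.
  rewrite -[LHS]fineK; last exact: integrable_fin_num.
  by congr EFin.
move/(ae_eq_integral_abs _ measurableT mi) => [N [mN N0 sub]].
have NT : N = setT.
  apply/seteqP; split => // x _; apply: sub => /(_ I) [] /eqP.
  by rewrite invr_eq0 gt_eqF.
by have := probability_setT mu; rewrite -NT N0 => /eqP; rewrite eq_sym onee_eq0.
Qed.

(* Chebyshev's association inequality for the decreasing functions
   [(x ^+ 2 + s)^-1] and [(x ^+ 2 + t)^-1] of [x ^+ 2]. *)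
Lemma square_stieltjes_assoc s t : 0 < s -> s <= t ->
  (t - s) * g s * g t <= g s - g t.
Proof.
move=> s0 st; have t0 : 0 < t by apply: lt_le_trans st.
have is_ := integrable_inv_sqrD mu s0; have it := integrable_inv_sqrD mu t0.
set c := g t; have c0 : 0 < c by exact: square_stieltjes_gt0.
set d := t - s; have d0 : 0 <= d by rewrite subr_ge0.
have cd : 0 < c^-1 - d.
  have : t <= c^-1.
    by rewrite -[t]invrK lef_pV2 ?posrE ?invr_gt0 // square_stieltjes_le.
  by rewrite /d; lra.
(* In terms of [y = (x ^+ 2 + t)^-1], the right-hand side of [pw] is
   [(1 - d * c) * y / (1 - d * y) - y], convex in [y], with value 0 and slope [k] at [y = c]. The
   left-hand side is the tangent there, and it integrates to 0 because [c] is the mean of [y]. *)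
pose k := d / (c^-1 - d).
have pw (x : R) : k * (x ^+ 2 + t)^-1 + - (k * c) <=
    (1 - d * c) * (x ^+ 2 + s)^-1 + -1 * (x ^+ 2 + t)^-1.
  have vs : 0 < x ^+ 2 + s by rewrite ltr_wpDl ?sqr_ge0.
  set v := x ^+ 2 + s in vs *; have -> : x ^+ 2 + t = v + d by rewrite /v /d; ring.
  have vd : 0 < v + d by rewrite ltr_pwDl.
  rewrite -subr_ge0 /k; set w := c^-1 in cd *; have -> : c = w^-1 by rewrite invrK.
  have w0 : 0 < w by rewrite invr_gt0.
  set lhs := (X in 0 <= X).
  have -> : lhs = d * (w - (v + d)) ^+ 2 / (v * (w - d) * (v + d) * w).
    by rewrite /lhs; field; rewrite !gt_eqF.
  by rewrite divr_ge0 //; [rewrite mulr_ge0 ?sqr_ge0 | rewrite ltW // !mulr_gt0].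
have : \int[mu]_x (k * (x ^+ 2 + t)^-1 + - (k * c)) <=
    \int[mu]_x ((1 - d * c) * (x ^+ 2 + s)^-1 + -1 * (x ^+ 2 + t)^-1).
  apply: le_Rintegral; first exact: measurableT.
  - by apply: integrable_addr;
      [exact: integrable_mulr|exact: integrable_probability_cst].
  - by apply: integrable_addr; exact: integrable_mulr.
  - by move=> x _; exact: pw.
rewrite !RintegralD //; try exact: integrable_mulr;
  try exact: integrable_probability_cst.
rewrite !RintegralZl // Rintegral_probability_cst -/(g s) -/(g t) -/c.
rewrite subrr mulN1r mulrBl mul1r [d * c * _]mulrAC; lra.
Qed.

Section Tonelli.
Variable l : R.
Hypothesis l0 : 0 < l.

(** The real power and the indicator make this total function jointly measurable on the plane, as
    Tonelli's theorem requires. *)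
Let q (x t : R) : R := (x ^+ 2 + l * t) `^ (-1) * \1_(`]0, +oo[%classic : set R) t.

Let qE x t : q x t = if 0 < t then (x ^+ 2 + l * t)^-1 else 0.
Proof.
rewrite /q indicE mem_setE in_itv /= andbT; case: ifP => t0; rewrite ?mulr0 //.
by rewrite mulr1 powR_inv1 // addr_ge0 ?sqr_ge0 // mulr_ge0 // ltW.
Qed.

Let q_ge0 x t : 0 <= q x t.
Proof.
rewrite qE; case: ifP => // t0.
by rewrite invr_ge0 addr_ge0 ?sqr_ge0 // mulr_ge0 // ltW.
Qed.

Let G t : R := if 0 < t then g (l * t) else 0.

Let G_ge0 t : 0 <= G t.
Proof.
by rewrite /G; case: ifP => // t0; rewrite ltW // square_stieltjes_gt0 // mulr_gt0.
Qed.

Let mq : measurable_fun setT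
  (fun p : measurableTypeR R * measurableTypeR R => q p.1 p.2).
Proof.
apply: measurable_funM.
  apply: (measurableT_comp (measurable_powR (-1))).
  apply: measurable_funD; first exact/measurable_funX.
  by apply: measurable_funM.
by apply: measurableT_comp => //; exact: measurable_indic.
Qed.

Let int_q t : (\int[mu]_x (q x t)%:E = (G t)%:E)%E.
Proof.
rewrite /G; case: ifPn => t0; last first.
  by under eq_integral do rewrite qE (negbTE t0); rewrite integral0.
under eq_integral do rewrite qE t0.
rewrite -[LHS]fineK //; apply: integrable_fin_num => //.
by apply: integrable_inv_sqrD; rewrite mulr_gt0.
Qed.

(** Measurability in [t] comes from Tonelli's theorem, [G] being a partial integral of [q]. *)
Let mG : measurable_fun setT (fun t : measurableTypeR R => (G t)%:E).
Proof.
under eq_fun do rewrite -int_q.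
apply: (measurable_fun_fubini_tonelli_G (m1 := mu)
  (fun p : measurableTypeR R * measurableTypeR R => (q p.1 p.2)%:E)).
  exact/measurable_EFinP.
by move=> p; rewrite lee_fin.
Qed.

Lemma measurable_square_stieltjes :
  measurable_fun (`]0%R, +oo[%classic : set (measurableTypeR R))
    (fun t : measurableTypeR R => (g (l * t) ^+ 2)%:E).
Proof.
have mGr : measurable_fun setT (G : measurableTypeR R -> R).
  exact/measurable_EFinP.
apply/measurable_EFinP/measurable_funX.
apply: (eq_measurable_fun (G : measurableTypeR R -> R)); last first.
  exact: measurable_funTS.
by move=> t; rewrite inE /= in_itv /= andbT /G => ->.
Qed.

Lemma fisher_square_stieltjes : (boolean_fisher_information mu =
  l%:E * \int[leb]_(t in `]0%R, +oo[) (g (l * t) ^+ 2)%:E)%E.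
Proof.
have kE x y : (fisher_kernel x y = l%:E * \int[leb]_t (q x t * q y t)%:E)%E.
  have -> : (\int[leb]_t (q x t * q y t)%:E = l^-1%:E * fisher_kernel x y)%E.
    rewrite -integral_fisher_kernel // [RHS]integral_mkcond.
    apply: eq_integral => t _.
    rewrite patchE mem_setE in_itv /= andbT !qE.
    case: ifP => _; last by rewrite mulr0.
    by rewrite invfM.
  by rewrite muleA -EFinM divff ?gt_eqF // mul1e.
have l0' : (0 <= l%:E)%E by rewrite lee_fin ltW.
have mGr : measurable_fun setT (G : measurableTypeR R -> R).
  exact/measurable_EFinP.
have mq2 t : measurable_fun setT (fun y : measurableTypeR R => (q y t)%:E).
  apply/measurable_EFinP.
  exact: (measurable_fun_pair1 (f := fun p => q p.1 p.2) t mq).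
have mqt x : measurable_fun setT
    (fun p : measurableTypeR R * measurableTypeR R => q x p.2).
  have := measurable_fun_pair2 (f := fun p => q p.1 p.2) x mq.
  by move/(measurableT_comp (f := fun t => q x t)); apply; exact: measurable_snd.
(* The first exchange integrates [q y t] over [y], which gives one factor [G t]. *)
have inner x : (\int[mu]_y fisher_kernel x y =
    l%:E * \int[leb]_t (q x t * G t)%:E)%E.
  under eq_integral do rewrite kE.
  pose f (p : measurableTypeR R * measurableTypeR R) := (q x p.2 * q p.1 p.2)%:E.
  have mf : measurable_fun setT f by apply/measurable_EFinP; exact: measurable_funM.
  have f0 p : (0 <= f p)%E by rewrite lee_fin mulr_ge0.
  rewrite ge0_integralZl //; last 2 first.
  - exact: (measurable_fun_fubini_tonelli_F (m2 := leb) f mf f0).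
  - by move=> y _; apply: integral_ge0 => t _; exact: (f0 (y, t)).
  congr (_ * _)%E; rewrite (fubini_tonelli f mf f0).
  apply: eq_integral => t _; under eq_integral do rewrite /f /= EFinM.
  rewrite ge0_integralZl ?lee_fin // ?int_q ?EFinM //.
  by move=> y _; rewrite lee_fin.
rewrite /boolean_fisher_information; under eq_integral do rewrite inner.
(* The second exchange integrates [q x t] over [x], which gives the other factor. *)
pose f (p : measurableTypeR R * measurableTypeR R) := (q p.1 p.2 * G p.2)%:E.
have mf : measurable_fun setT f.
  by apply/measurable_EFinP; apply: measurable_funM => //; exact: measurableT_comp.
have f0 p : (0 <= f p)%E by rewrite lee_fin mulr_ge0.
rewrite ge0_integralZl //; last 2 first.
- exact: (measurable_fun_fubini_tonelli_F (m2 := leb) f mf f0).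
- by move=> y _; apply: integral_ge0 => t _; exact: (f0 (y, t)).
congr (_ * _)%E; rewrite (fubini_tonelli f mf f0) [RHS]integral_mkcond.
apply: eq_integral => t _; under eq_integral do rewrite /f /= mulrC EFinM.
rewrite ge0_integralZl ?lee_fin // ?int_q -?EFinM; last first.
  by move=> y _; rewrite lee_fin.
rewrite patchE mem_setE in_itv /= andbT /G; case: ifP => _; last by rewrite mulr0.
by rewrite expr2.
Qed.

End Tonelli.

End SquareStieltjes.

(** * The Stam inequality *)

Section Stam.
Context (R : realType) (muX muY muXY : probability (measurableTypeR R) R).
Local Notation leb := (@lebesgue_measure R).
Local Notation gX := (square_stieltjes muX).
Local Notation gY := (square_stieltjes muY).
Local Notation gXY := (square_stieltjes muXY).

(** This is [square_stieltjes_assoc] divided by both transforms: [1 / g t - t] is nondecreasing. *)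
Lemma square_stieltjes_invB (mu : probability (measurableTypeR R) R) (s t : R) :
  0 < s -> s <= t ->
  t - s <= (square_stieltjes mu t)^-1 - (square_stieltjes mu s)^-1.
Proof.
move=> s0 st; have t0 : 0 < t by apply: lt_le_trans st.
have gs := square_stieltjes_gt0 mu s0; have gt := square_stieltjes_gt0 mu t0.
have := square_stieltjes_assoc mu s0 st.
move: gs gt; set a := square_stieltjes mu s; set b := square_stieltjes mu t => a0 b0.
rewrite -ler_pdivlMr // -ler_pdivlMr //.
by have -> : (a - b) / b / a = b^-1 - a^-1 by field; rewrite !gt_eqF.
Qed.

(** Jensen's inequality for the inverse square at [p / l] and [q / m], with weights [l] and [m]. *)
Lemma inv_sqr_convex (l m p q : R) : 0 < l -> 0 < m -> l + m = 1 -> 0 < p -> 0 < q ->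
  (p + q)^-1 ^+ 2 <= l ^+ 3 * p^-1 ^+ 2 + m ^+ 3 * q^-1 ^+ 2.
Proof.
move=> l0 m0 lm p0 q0; have s0 : 0 < p + q by rewrite addr_gt0.
(* The tangent of [x |-> k ^+ 3 / x ^+ 2] at [x = k * (p + q)]. *)
have tangent (k x : R) : 0 < k -> 0 < x ->
    (3 * k - 2 * x / (p + q)) / (p + q) ^+ 2 <= k ^+ 3 * x^-1 ^+ 2.
  move=> k0 x0; rewrite -subr_ge0.
  have -> : k ^+ 3 * x^-1 ^+ 2 - (3 * k - 2 * x / (p + q)) / (p + q) ^+ 2 =
      (k * (p + q) - x) ^+ 2 * (k * (p + q) + 2 * x) / (x ^+ 2 * (p + q) ^+ 3).
    by field; rewrite !gt_eqF.
  have ks : 0 < k * (p + q) by rewrite mulr_gt0.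
  rewrite divr_ge0 //; first by rewrite mulr_ge0 ?sqr_ge0 //; lra.
  by rewrite mulr_ge0 ?exprn_ge0 ?ltW.
(* As [l + m = 1], the two tangents add up to [(3 - 2) / (p + q) ^+ 2]. *)
apply: le_trans (lerD (tangent l p l0 p0) (tangent m q m0 q0)).
rewrite le_eqVlt; apply/orP; left; apply/eqP.
have -> : m = 1 - l by rewrite -lm addrC addKr.
by field; rewrite gt_eqF.
Qed.

Hypothesis boolean_stieltjes : forall t, 0 < t ->
  gX t * gY t = (gX t + gY t - t * gX t * gY t) * gXY t.

Lemma square_stieltjes_invD t : 0 < t -> (gXY t)^-1 = (gX t)^-1 + (gY t)^-1 - t.
Proof.
move=> t0; have := boolean_stieltjes t0.
have := square_stieltjes_gt0 muX t0; have := square_stieltjes_gt0 muY t0.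
have := square_stieltjes_gt0 muXY t0.
set a := gX t; set b := gY t; set c := gXY t => c0 b0 a0 h.
have c0' : c != 0 by rewrite gt_eqF.
apply: (mulIf c0'); rewrite mulVf //.
apply: (mulfI (lt0r_neq0 (mulr_gt0 a0 b0))); rewrite mulr1 {1}h.
by field; rewrite !gt_eqF.
Qed.

Lemma square_stieltjes_le_l t : 0 < t -> gXY t <= gX t.
Proof.
move=> t0; have [[aX aY] aXY] := (square_stieltjes_gt0 muX t0,
  square_stieltjes_gt0 muY t0, square_stieltjes_gt0 muXY t0).
rewrite -lef_pV2 ?posrE // square_stieltjes_invD //.
have : t <= (gY t)^-1.
  by rewrite -[leLHS]invrK lef_pV2 ?posrE ?invr_gt0 ?square_stieltjes_le.
by lra.
Qed.

Lemma square_stieltjes_stam (l m t : R) : 0 < l -> 0 < m -> l + m = 1 -> 0 < t ->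
  gXY t ^+ 2 <= l ^+ 3 * gX (l * t) ^+ 2 + m ^+ 3 * gY (m * t) ^+ 2.
Proof.
move=> l0 m0 lm t0; have [lt0 mt0] := (mulr_gt0 l0 t0, mulr_gt0 m0 t0).
have [[aX aY] aXY] := (square_stieltjes_gt0 muX lt0, square_stieltjes_gt0 muY mt0,
  square_stieltjes_gt0 muXY t0).
have lt1 : l * t <= t by rewrite ger_pMl //; lra.
have mt1 : m * t <= t by rewrite ger_pMl //; lra.
have hX := square_stieltjes_invB muX lt0 lt1.
have hY := square_stieltjes_invB muY mt0 mt1.
have h := square_stieltjes_invD t0.
have iX : 0 < (gX (l * t))^-1 by rewrite invr_gt0.
have iY : 0 < (gY (m * t))^-1 by rewrite invr_gt0.
have := inv_sqr_convex l0 m0 lm iX iY; rewrite !invrK; apply: le_trans.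
have iXY := addr_gt0 iX iY.
apply: lerXn2r; rewrite ?nnegrE ?invr_ge0 ?(ltW aXY) ?(ltW iXY) //.
rewrite -[gXY t]invrK lef_pV2 ?posrE ?invr_gt0 // h.
(* By [hX] and [hY], passing from [l * t] and [m * t] to [t] gains [m * t] and [l * t]; together
   these compensate the [- t] in [h]. *)
have : l * t + m * t = t by rewrite -mulrDl lm mul1r.
by lra.
Qed.

Let fisherE (mu : probability (measurableTypeR R) R) :
  (boolean_fisher_information mu =
   \int[leb]_(t in `]0%R, +oo[) (square_stieltjes mu t ^+ 2)%:E)%E.
Proof.
rewrite (fisher_square_stieltjes mu ltr01) mul1e.
by apply: eq_integral => t _; rewrite mul1r.
Qed.

Let measurable_g (mu : probability (measurableTypeR R) R) :
  measurable_fun (`]0%R, +oo[%classic : set (measurableTypeR R))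
    (fun t : measurableTypeR R => (square_stieltjes mu t ^+ 2)%:E).
Proof.
apply: (eq_measurable_fun _ _ (measurable_square_stieltjes mu ltr01)) => t _.
by rewrite mul1r.
Qed.

Lemma fisher_information_ge0 (mu : probability (measurableTypeR R) R) :
  (0 <= boolean_fisher_information mu)%E.
Proof. by rewrite fisherE; apply: integral_ge0 => t _; rewrite lee_fin sqr_ge0. Qed.

(** This handles infinite information, where the weighted inequality says nothing. *)
Lemma fisher_information_le_l :
  (boolean_fisher_information muXY <= boolean_fisher_information muX)%E.
Proof.
rewrite !fisherE; apply: ge0_le_integral => //.
  by move=> t _; rewrite lee_fin sqr_ge0.
move=> t; rewrite /= in_itv /= andbT => t0; rewrite lee_fin.
by rewrite lerXn2r ?nnegrE ?(ltW (square_stieltjes_gt0 _ t0)) ?square_stieltjes_le_l.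
Qed.

Lemma fisher_information_stam (l m : R) : 0 < l -> 0 < m -> l + m = 1 ->
  (boolean_fisher_information muXY <=
   (l ^+ 2)%:E * boolean_fisher_information muX +
   (m ^+ 2)%:E * boolean_fisher_information muY)%E.
Proof.
move=> l0 m0 lm.
(* The scale in [fisher_square_stieltjes] absorbs one of the three powers of [k]. *)
have cube (k : R) (mu : probability (measurableTypeR R) R) : 0 < k ->
    ((k ^+ 2)%:E * boolean_fisher_information mu =
     \int[leb]_(t in `]0%R, +oo[) (k ^+ 3 * square_stieltjes mu (k * t) ^+ 2)%:E)%E.
  move=> k0; under eq_integral do rewrite EFinM.
  rewrite ge0_integralZl ?lee_fin ?exprn_ge0 ?(ltW k0) //.
  - by rewrite (fisher_square_stieltjes mu k0) muleA -EFinM -exprSr.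
  - exact: measurable_square_stieltjes.
  - by move=> t _; rewrite lee_fin sqr_ge0.
have mcube : forall (k : R) (mu : probability (measurableTypeR R) R), 0 < k ->
    measurable_fun (`]0%R, +oo[%classic : set (measurableTypeR R))
    (fun t : measurableTypeR R => (k ^+ 3 * square_stieltjes mu (k * t) ^+ 2)%:E).
  move=> k mu k0.
  have := measurable_funeM (k ^+ 3)%:E (measurable_square_stieltjes mu k0).
  by apply: eq_measurable_fun => t _; rewrite EFinM.
have cube0 (k x : R) : 0 < k -> (0 <= (k ^+ 3 * x ^+ 2)%:E)%E.
  by move=> k0; rewrite lee_fin mulr_ge0 ?sqr_ge0 // exprn_ge0 ?ltW.
rewrite fisherE !cube // -ge0_integralD //.
- apply: ge0_le_integral => //.
  + by move=> t _; rewrite lee_fin sqr_ge0.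
  + by apply: emeasurable_funD; exact: mcube.
  + move=> t; rewrite /= in_itv /= andbT => t0.
    by rewrite -EFinD lee_fin square_stieltjes_stam.
- by move=> t _; exact: cube0.
- exact: mcube.
- by move=> t _; exact: cube0.
- exact: mcube.
Qed.

End Stam.

(** * Optimal weights and the inequality between inverses *)

Local Open Scope ereal_scope.

(** If [A] or [B] is infinite, its inverse is 0 and the comparison of [C] with the other one
    suffices. Otherwise the weights are optimized. *)
Lemma inveD_le_of_stam (R : realType) (A B C : \bar R) :
  0 <= A -> 0 <= B -> 0 <= C -> C <= A -> C <= B ->
  (forall l m : R, (0 < l)%R -> (0 < m)%R -> (l + m = 1)%R ->
    C <= (l ^+ 2)%:E * A + (m ^+ 2)%:E * B) ->
  A^-1 + B^-1 <= C^-1.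
Proof.
move=> A0 B0 C0 CA CB stam.
have inv_le (x : \bar R) : 0 <= x -> C <= x -> x^-1 <= C^-1.
  by move=> x0 Cx; rewrite lee_pV2.
case: A B A0 B0 CA CB stam => [a| | ] [b| | ] // A0 B0 CA CB stam; last 3 first.
- by rewrite invey adde0 (inv_le _ A0 CA).
- by rewrite invey add0e (inv_le _ B0 CB).
- by rewrite invey add0e (inv_le _ B0 CB).
have [->|C_neq0] := eqVneq C 0; first by rewrite inve0 leey.
have {C_neq0} : 0 < C by rewrite lt_neqAle eq_sym C_neq0.
case: C C0 CA CB stam inv_le => [c| | ] // _.
rewrite !lee_fin lte_fin => ca cb stam _ c0.
have a0 : (0 < a)%R by exact: lt_le_trans ca.
have b0 : (0 < b)%R by exact: lt_le_trans cb.
have ab0 : (0 < a + b)%R by rewrite addr_gt0.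
(* These weights minimize [l ^+ 2 * a + m ^+ 2 * b]; the minimum is [a * b / (a + b)], the inverse
   of [a^-1 + b^-1]. *)
have := stam (b / (a + b))%R (a / (a + b))%R (divr_gt0 b0 ab0) (divr_gt0 a0 ab0).
rewrite -mulrDl [(b + a)%R]addrC divff ?gt_eqF // => /(_ erefl).
rewrite -!EFinM -EFinD lee_fin !inver !gt_eqF // -EFinD lee_fin => h.
rewrite -[leLHS]invrK lef_pV2 ?posrE ?invr_gt0 ?addr_gt0 ?invr_gt0 //.
apply: le_trans h _; rewrite le_eqVlt; apply/orP; left; apply/eqP.
by field; rewrite [(b + a)%R]addrC !gt_eqF.
Qed.

Theorem corollary1p10 (R : realType) (W : ncProbSpace R) (X Y : 'op(W))
    (muX muY muXY : probability (measurableTypeR R) R)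
    (rvX : selfadjoint_element X) (rvY : selfadjoint_element Y)
    (lawX : is_law X muX) (lawY : is_law Y muY)
    (lawXY : is_law (X \+ Y)%R muXY)
    (symX : symmetric_measure muX) (symY : symmetric_measure muY)
    (indXY : boolean_independent X Y) :
  let PsiX := boolean_fisher_information muX in
  let PsiY := boolean_fisher_information muY in
  let PsiXY := boolean_fisher_information muXY in
  PsiXY^-1 >= PsiX^-1 + PsiY^-1 /\
  (PsiXY = +oo -> PsiX = +oo /\ PsiY = +oo).
Proof.
case: rvX => MX sX; case: rvY => MY sY.
pose x : ncalg W := exist _ X (introT (in_nc_algP X) MX).
pose y : ncalg W := exist _ Y (introT (in_nc_algP Y) MY).
have key t : (0 < t)%R ->
    (square_stieltjes muX t * square_stieltjes muY t =
     (square_stieltjes muX t + square_stieltjes muY t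
      - t * square_stieltjes muX t * square_stieltjes muY t) *
     square_stieltjes muXY t)%R.
  exact: (@square_stieltjes_boolean _ _ x y).
(* Exchanging the roles of [X] and [Y] gives the comparison with [PsiY]. *)
have key' t : (0 < t)%R ->
    (square_stieltjes muY t * square_stieltjes muX t =
     (square_stieltjes muY t + square_stieltjes muX t
      - t * square_stieltjes muY t * square_stieltjes muX t) *
     square_stieltjes muXY t)%R.
  by move=> /key; rewrite mulrC => ->; congr (_ * _)%R; ring.
have CA := fisher_information_le_l key; have CB := fisher_information_le_l key'.
move=> PsiX PsiY PsiXY; split.
  apply: inveD_le_of_stam => //; try exact: fisher_information_ge0.
  by move=> l m; exact: fisher_information_stam.
by move=> e; move: CA CB; rewrite -/PsiXY e !leye_eq => /eqP hX /eqP hY.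
Qed.
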